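(* Let $\varphi\in[0,2\pi)$, $a,b\in\mathbb{C}$, $c,k,m\in\mathbb{R}$, and $$L=T_1\begin{pmatrix} c&0&0&0\\0&c&0&0\\0&0&a&b\\0&0&e^{2ik}\bar b&a+me^{ik}\end{pmatrix}T_1^\dagger,\qquad T_1=\begin{pmatrix}1&0&0&0\\0&\frac1{\sqrt2}&\frac1{\sqrt2}&0\\0&\frac{e^{i\varphi}}{\sqrt2}&-\frac{e^{i\varphi}}{\sqrt2}&0\\0&0&0&1\end{pmatrix}.$$ Let $|\psi_1\rangle=\frac1{\sqrt2}(|01\rangle+e^{i\varphi}|10\rangle)$, $|\psi_2\rangle=\frac1{\sqrt2}(|01\rangle-e^{i\varphi}|10\rangle)$, $P=|00\rangle\langle00|+|\psi_1\rangle\langle\psi_1|$, $\tilde P=|11\rangle\langle11|+|\psi_2\rangle\langle\psi_2|$. (i) If $b\neq0$, then the attractor space of the semigroup generated by $L$ and $H$ has the orthonormal (Hilbert–Schmidt) basis $$|00\rangle\langle00|,\ |\psi_1\rangle\langle\psi_1|,\ |00\rangle\langle\psi_1|,\ |\psi_1\rangle\langle00|,\ \tfrac1{\sqrt2}\tilde P,$$ whose elements are eigenvectors of $\mathcal L$ with eigenvalues $0,0,-i\Delta E,i\Delta E,0$ respectively, and for every initial state $\rho(0)$ the asymptotic dynamics is $$\rho_{as}(t)=e^{-iHt}P\rho(0)Pe^{iHt}+\frac{\mathrm{Tr}(\tilde P\rho(0))}{2}\tilde P .$$ (ii) If $b=0$, $a\neq c$, $m\neq0$ and $m\neq e^{-ik}(c-a)$,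 then the attractor space has the orthonormal basis $$|00\rangle\langle00|,\ |\psi_1\rangle\langle\psi_1|,\ |00\rangle\langle\psi_1|,\ |\psi_1\rangle\langle00|,\ |\psi_2\rangle\langle\psi_2|,\ |11\rangle\langle11|,$$ with eigenvalues $0,0,-i\Delta E,i\Delta E,0,0$ respectively, and $$\rho_{as}(t)=e^{-iHt}P\rho(0)Pe^{iHt}+\langle11|\rho(0)|11\rangle\,|11\rangle\langle11|+\langle\psi_2|\rho(0)|\psi_2\rangle\,|\psi_2\rangle\langle\psi_2| .$$
   Context: Hilbert space $\mathbb{C}^2\otimes\mathbb{C}^2$, $|ij\rangle=|i\rangle\otimes|j\rangle$; matrices are in the ordered basis $(|00\rangle,|01\rangle,|10\rangle,|11\rangle)$. $H=H_0\otimes I+I\otimes H_0$ with $H_0=\mathrm{diag}(E_0,E_1)$, $E_0,E_1\in\mathbb{R}$, $\Delta E=E_0-E_1\neq0$. The generator is $\mathcal L(\rho)=-i[H,\rho]+L\rho L^\dagger-\frac12\{L^\dagger L,\rho\}$, $\mathcal T_t=e^{t\mathcal L}$. The attractor space is the direct sum of $\ker(\mathcal L-\lambda I)$ over all purely imaginary eigenvalues $\lambda$ (including $0$) of $\mathcal L$. The asymptotic dynamics of $\rho(t)=\mathcal T_t(\rho(0))$ is the trajectory $\rho_{as}(t)=\mathcal T_t(\rho_{as}(0))$ inside the attractor space with $\lim_{t\to\infty}\|\rho(t)-\rho_{as}(t)\|=0$; it equals $\sum_{\lambda,i}e^{\lambda t}\mathrm{Tr}(X_{\lambda,i}^\dagger\rho(0))X_{\lambda,i}$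 for an orthonormal basis of attractors $X_{\lambda,i}$. *)

(* Defs.v *)
From HB Require Import structures.
From mathcomp Require Import all_boot all_order all_algebra.
From mathcomp Require Import complex mxtens.
From mathcomp Require Import ring.
From mathcomp Require Import all_classical all_reals all_analysis.

Set Implicit Arguments.
Unset Strict Implicit.
Unset Printing Implicit Defensive.

Import Order.TTheory GRing.Theory Num.Theory.
Import numFieldNormedType.Exports.

Local Open Scope classical_set_scope.
Local Open Scope complex_scope.
Local Open Scope ring_scope.

(* The library gives this topology to R[i] only through its alias R[i]^o. *)
HB.instance Definition _ (R : realType) :=
  NormedModule.copy R[i] R[i]^o.

Definition cis {R : realType} (x : R) : R[i] := (cos x +i* sin x)%C.

Definition adjmx {R : realType} {m n : nat} (A : 'M[R[i]]_(m, n)) :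
  'M[R[i]]_(n, m) := map_mx Num.conj A^T.

Definition ketbra {R : realType} {n : nat} (u v : 'cV[R[i]]_n) : 'M[R[i]]_n :=
  u *m adjmx v.

Definition braket_mx {R : realType} {n : nat} (u : 'cV[R[i]]_n)
  (A : 'M[R[i]]_n) (v : 'cV[R[i]]_n) : R[i] := (adjmx u *m A *m v) 0 0.

Definition hs_dot {R : realType} {n : nat} (X Y : 'M[R[i]]_n) : R[i] :=
  \tr (adjmx X *m Y).

Definition hs_orthonormal {R : realType} {n : nat} (X : seq 'M[R[i]]_n) :
    Prop :=
  forall i j : nat, (i < size X)%N -> (j < size X)%N ->
    hs_dot X`_i X`_j = (i == j)%:R.

(* The order of R[i] is partial: 0 <= z means that z is real and nonnegative,
   so the first condition also makes rho Hermitian. *)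
Definition density {R : realType} {n : nat} (rho : 'M[R[i]]_n) : Prop :=
  (forall v : 'cV[R[i]]_n, 0 <= braket_mx v rho v) /\ \tr rho = 1.

Definition expmx {R : realType} {n : nat} (A : 'M[R[i]]_n.+1) :
    'M[R[i]]_n.+1 :=
  limn (series (fun k => (k`!%:R)^-1 *: A ^+ k)).

(* e^{-iHt} *)
Definition evolution {R : realType} {n : nat} (H : 'M[R[i]]_n.+1) (t : R) :
    'M[R[i]]_n.+1 :=
  expmx (- ('i * t%:C)%C *: H).

Definition lindblad {R : realType} {n : nat} (H L rho : 'M[R[i]]_n) :
    'M[R[i]]_n :=
  - ('i)%C *: (H *m rho - rho *m H) + L *m rho *m adjmx L
  - 2^-1 *: (adjmx L *m L *m rho + rho *m (adjmx L *m L)).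

Lemma lindblad_is_linear (R : realType) (n : nat) (H L : 'M[R[i]]_n) :
  linear (lindblad H L).
Proof.
move=> z X Y; rewrite /lindblad !(mulmxDr, mulmxDl) -!scalemxAr -!scalemxAl.
set A := H *m X; set B := X *m H; set D := L *m X *m _.
set E := _ *m X; set F := X *m _; clearbody A B D E F.
set A' := H *m Y; set B' := Y *m H; set D' := L *m Y *m _.
set E' := _ *m Y; set F' := Y *m _; clearbody A' B' D' E' F'.
by apply/matrixP => i j; rewrite !mxE; ring.
Qed.

HB.instance Definition _ (R : realType) (n : nat) (H L : 'M[R[i]]_n) :=
  GRing.isLinear.Build R[i] 'M[R[i]]_n 'M[R[i]]_n *:%R (lindblad H L)
    (lindblad_is_linear H L).

(* exp (t * lindblad H L), applied to rho *)
Definition semigroup {R : realType} {n : nat} (H L : 'M[R[i]]_n.+1) (t : R)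
    (rho : 'M[R[i]]_n.+1) : 'M[R[i]]_n.+1 :=
  limn (series (fun k => (t%:C ^+ k / k`!%:R)%C *: iter k (lindblad H L) rho)).

(* All but finitely many of the eigenspaces are trivial, so this finitely
   supported sum is the sum over all purely imaginary eigenvalues; a sum of
   eigenspaces for distinct eigenvalues is direct. *)
Definition attractor_space {R : realType} {n : nat} (H L : 'M[R[i]]_n) :
    {vspace 'M[R[i]]_n} :=
  \big[addv/0%VS]_(l \in [set l : R[i] | complex.Re l = 0])
     passmx.leigenspace (linfun (lindblad H L)) l.

Definition attractor_eigenbasis {R : realType} {n : nat} (H L : 'M[R[i]]_n)
    (X : seq 'M[R[i]]_n) (lambda : seq R[i]) : Prop :=
  [/\ basis_of (attractor_space H L) X,
      hs_orthonormal X,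
      size lambda = size X &
      forall j : nat, (j < size X)%N ->
        lindblad H L X`_j = lambda`_j *: X`_j].

(* The trajectory is only constrained at times t >= 0. The library norm on
   matrices is the largest modulus of an entry; all norms are equivalent here. *)
Definition asymptotic_dynamics {R : realType} {n : nat}
    (H L : 'M[R[i]]_n.+1) (rho : 'M[R[i]]_n.+1) (rho_as : R -> 'M[R[i]]_n.+1) :
    Prop :=
  [/\ forall t : R, 0 <= t -> rho_as t \in attractor_space H L,
      forall t : R, 0 <= t -> rho_as t = semigroup H L t (rho_as 0) &
      `|semigroup H L t rho - rho_as t| @[t --> +oo] --> (0 : R[i])].

Definition mx4_of_rows {R : realType} (rows : seq (seq R[i])) : 'M[R[i]]_4 :=
  \matrix_(i, j) nth 0 (nth [::] rows i) j.

Definition ham1 {R : realType} (E0 E1 : R) : 'M[R[i]]_2 :=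
  diag_mx (\row_j (if j == 0 then E0 else E1)%:C%C).

(* The tensor product has type 'M_(2 * 2, 2 * 2), convertible to 'M_4. *)
Definition ham {R : realType} (E0 E1 : R) : 'M[R[i]]_4 :=
  ham1 E0 E1 *t 1%:M + 1%:M *t ham1 E0 E1.

Definition ket1 {R : realType} (i : 'I_2) : 'cV[R[i]]_2 := delta_mx i 0.

Definition ket {R : realType} (i j : 'I_2) : 'cV[R[i]]_4 := ket1 i *t ket1 j.

Definition isqrt2 {R : realType} : R[i] := ((Num.sqrt 2)^-1)%:C%C.

Definition psi1 {R : realType} (phi : R) : 'cV[R[i]]_4 :=
  isqrt2 *: (ket 0 1 + cis phi *: ket 1 0).

Definition psi2 {R : realType} (phi : R) : 'cV[R[i]]_4 :=
  isqrt2 *: (ket 0 1 - cis phi *: ket 1 0).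

Definition projP {R : realType} (phi : R) : 'M[R[i]]_4 :=
  ketbra (ket 0 0) (ket 0 0) + ketbra (psi1 phi) (psi1 phi).

Definition projPt {R : realType} (phi : R) : 'M[R[i]]_4 :=
  ketbra (ket 1 1) (ket 1 1) + ketbra (psi2 phi) (psi2 phi).

Definition T1 {R : realType} (phi : R) : 'M[R[i]]_4 :=
  mx4_of_rows
    [:: [:: 1; 0; 0; 0];
        [:: 0; isqrt2; isqrt2; 0];
        [:: 0; cis phi * isqrt2; - (cis phi * isqrt2); 0];
        [:: 0; 0; 0; 1]].

Definition lindblad_op {R : realType} (phi : R) (a b : R[i]) (c k m : R) :
    'M[R[i]]_4 :=
  T1 phi *m
  mx4_of_rows
    [:: [:: c%:C; 0; 0; 0];
        [:: 0; c%:C; 0; 0];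
        [:: 0; 0; a; b];
        [:: 0; 0; cis (2 * k) * Num.conj b; a + m%:C * cis k]]%C *m
  adjmx (T1 phi).

(* Main.v *)
(* Since L is normal, 2 Re <X, Lind X> = - ||[L, X]||^2 for the Hilbert-Schmidt
   product. Hence an eigenvector of the generator for an eigenvalue with nonnegative
   real part commutes with L and L^*, so it is an eigenvector of -i[H, .], and it is
   also a left eigenvector. The orthogonal complement of the attractors is therefore
   invariant and carries only eigenvalues with negative real part; by Cayley-Hamilton
   a product of shifts Lind - mu with Re mu < 0 kills it, and each shift is undone
   by a scalar damped equation, so the flow tends to 0 there.
   For the given L, conjugation by T1 leaves H diagonal and turns the commutation
   relations into equations between matrix entries, in which Delta E <> 0 separates
   the Bohr frequencies. *)

Require Import Defs.
From HB Require Import structures.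
From mathcomp Require Import all_boot all_order all_algebra.
From mathcomp Require Import complex mxtens.
From mathcomp Require Import ring.
From mathcomp Require Import all_classical all_reals all_analysis.

Set Implicit Arguments.
Unset Strict Implicit.
Unset Printing Implicit Defensive.

Import Order.TTheory GRing.Theory Num.Theory.
Import numFieldNormedType.Exports.

Local Open Scope classical_set_scope.
Local Open Scope complex_scope.
Local Open Scope ring_scope.


(** * Exponential flow of a linear operator *)

(** The generator is not shown to be diagonalizable on the complement of the attractors, so decay
    cannot be read off from a basis of eigenvectors. Undoing one shift at a time avoids this: the
    entries of the flow of [X] solve z' = mu z + h, where h comes from the flow of the shifted
    vector and is only known to tend to 0. No rate of decay is tracked, so polynomial factors from
    repeated roots never appear. Differentiation takes place over the reals, hence the splitting of
    every entry into two real power series. The formula for the asymptotic dynamics is an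
    equivalence, so uniqueness is needed besides convergence. It comes from the opposite behaviour
    on the attractors, where each coefficient keeps its modulus for all times. *)

Lemma cvg_complexP (R : realType) (T : Type) (F : set_system T) (FF : Filter F)
    (f : T -> R[i]) (z : R[i]) :
  f t @[t --> F] --> z <->
  (complex.Re (f t) @[t --> F] --> complex.Re z /\
   complex.Im (f t) @[t --> F] --> complex.Im z).
Proof.
have ReB (x y : R[i]) : complex.Re x - complex.Re y = complex.Re (x - y).
  by case: x y => [? ?] [? ?].
have ImB (x y : R[i]) : complex.Im x - complex.Im y = complex.Im (x - y).
  by case: x y => [? ?] [? ?].
have leRe (x : R[i]) : `|complex.Re x| <= complex.Re `|x|.
  by have := normc_ge_Re x; rewrite lecE => /andP[].
(* Multiplication by -i has modulus one and carries the imaginary part to the real part, so the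
   bound on real parts serves both. *)
have ImRe (x : R[i]) : complex.Im x = complex.Re (- 'i%C * x).
  by case: x => ? ?; simpc.
have nI : `|- 'i%C : R[i]| = 1.
  by rewrite normrN normc_def /= expr0n add0r expr1n sqrtr1.
split=> [/cvgrPdist_lt fz|[/cvgrPdist_lt fr /cvgrPdist_lt fi]].
  split; apply/cvgrPdist_lt => e e0;
    (apply: (filterS _ (fz e%:C%C _)); last by rewrite ltcR) => t;
    rewrite ltcE => /andP[_ /= ze].
    by rewrite ReB; exact: le_lt_trans (leRe _) ze.
  rewrite ImB ImRe; apply: le_lt_trans (leRe _) _.
  by rewrite normrM nI mul1r.
apply/cvgrPdist_lt => e; rewrite ltcE => /andP[/eqP /= ei e0].
have h0 : 0 < complex.Re e / 2 by rewrite divr_gt0.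
near=> t.
rewrite [z - f t]complexE -ReB -ImB (le_lt_trans (ler_normD _ _))//.
rewrite normrM -[`|'i%C|]normrN nI mul1r.
have nr (x : R) : `|x%:C%C : R[i]| = `|x|%:C%C.
  by rewrite normc_def /= expr0n addr0 sqrtr_sqr.
rewrite !nr -rmorphD ltcE /= ei eqxx /=.
have : `|complex.Re z - complex.Re (f t)| < complex.Re e / 2.
  by near: t; exact: fr.
have : `|complex.Im z - complex.Im (f t)| < complex.Re e / 2.
  by near: t; exact: fi.
by move=> hi hr; rewrite (splitr (complex.Re e)) ltrD.
Unshelve. all: by end_near. Qed.

Lemma cvg_matrixP (K : numFieldType) (T : Type) (F : set_system T)
    (FF : Filter F) (m n : nat) (M : T -> 'M[K]_(m, n)) (N : 'M[K]_(m, n)) :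
  M t @[t --> F] --> N <-> forall i j, M t i j @[t --> F] --> N i j.
Proof.
split=> [MN i j|MN].
  exact: cvg_comp MN (@coord_continuous K m n i j N).
apply/cvgrPdist_lt => e e0.
have : \forall t \near F, forall ij : 'I_m * 'I_n, `|N ij.1 ij.2 - M t ij.1 ij.2| < e.
  apply: filter_forall => -[i j] /=.
  by have /cvgrPdist_lt := MN i j; apply.
apply: filterS => t H.
have : ball N e (M t) by split=> // i j; exact: (H (i, j)).
by rewrite mx_norm_ball.
Qed.

Lemma le_mx_norm (K : numFieldType) (m n : nat) (M : 'M[K]_(m, n)) i j :
  `|M i j| <= `|M|.
Proof.
rewrite [leRHS]/Num.Def.normr /= mx_normE -[leLHS]nngE num_le.
exact: (@le_bigmax _ _ _ 0%:nng%R (fun x : 'I_m * 'I_n => `|M x.1 x.2|%:nng) (i, j)).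
Qed.

Lemma lin_mx_norm_bounded (K : numFieldType) (m n : nat)
    (f : {linear 'M[K]_(m, n) -> 'M[K]_(m, n)}) :
  exists2 B : K, 0 <= B & forall X, `|f X| <= B * `|X|.
Proof.
exists (\sum_i \sum_j `|f (delta_mx i j)|) => [|X].
  by apply: sumr_ge0 => i _; apply: sumr_ge0.
rewrite {1}[X]matrix_sum_delta linear_sum.
rewrite (le_trans (ler_norm_sum _ _ _))// mulr_suml ler_sum// => i _.
rewrite linear_sum (le_trans (ler_norm_sum _ _ _))// mulr_suml ler_sum// => j _.
by rewrite linearZ normrZ mulrC ler_wpM2l// le_mx_norm.
Qed.

(** * Entries of the exponential series as real power series *)

Section LinearFlow.
Variables (R : realType) (n : nat).
Implicit Types (f : {linear 'M[R[i]]_n.+1 -> 'M[R[i]]_n.+1}).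
Implicit Types (X : 'M[R[i]]_n.+1) (t : R).

(** Only real parts are needed: as [f] is complex linear, the imaginary part of an entry of f^k X is
    the real part of that entry of f^k (-i X). *)
Definition flow_coeff f X i j : nat -> R :=
  fun k => complex.Re (iter k f X i j) / k`!%:R.

Definition flow_re f X i j t : R := limn (pseries (flow_coeff f X i j) t).

Lemma le_norm_iter f X : exists2 B : R, 0 <= B &
  exists2 D : R, 0 <= D &
    forall k i j, `|complex.Re (iter k f X i j)| <= D * B ^+ k.
Proof.
have [b b0 fb] := lin_mx_norm_bounded f.
have bE : b = (complex.Re b)%:C%C by rewrite RRe_real// ger0_real.
have xE : `|X| = (complex.Re `|X|)%:C%C by rewrite RRe_real// ger0_real.
exists (complex.Re b); first by rewrite -ler0c -bE.
exists (complex.Re `|X|); first by rewrite -ler0c -xE.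
have fk k : `|iter k f X| <= `|X| * b ^+ k.
  elim: k => [|k IH]; first by rewrite expr0 mulr1.
  by rewrite iterS (le_trans (fb _))// exprSr mulrA [leRHS]mulrC ler_wpM2l.
move=> k i j; rewrite -lecR rmorphM rmorphXn /= -bE -xE.
by rewrite (le_trans (normc_ge_Re _))// (le_trans (le_mx_norm _ _ _)).
Qed.

(** The geometric bound of [le_norm_iter] puts the series below D exp (B |t|), so it converges for
    every [t]. *)
Lemma is_cvg_flow_coeff f X i j t : cvgn (pseries (flow_coeff f X i j) t).
Proof.
have [B B0 [D D0 fB]] := le_norm_iter f X.
apply: normed_cvg.
apply: (@series_le_cvg _ _ (fun k => D * exp_coeff (B * `|t|) k)) => //.
- by move=> k /=; exact: normr_ge0.
- by move=> k /=; rewrite mulr_ge0// exp_coeff_ge0// mulr_ge0.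
- move=> k; rewrite /flow_coeff /exp_coeff /= !normrM normfV normr_nat normrX.
  rewrite exprMn mulrAC [leRHS]mulrA [D * (_ * _)]mulrA ler_wpM2r ?invr_ge0//.
  by rewrite ler_wpM2r ?exprn_ge0// fB.
- exact/is_cvg_seriesZ/is_cvg_series_exp_coeff.
Qed.

(** The derivative of e^{tf} X is e^{tf} (f X), at the level of coefficients: (k+1) / (k+1)! = 1 /
    k! and f^{k+1} X = f^k (f X). *)
Lemma pseries_diffs_flow_coeff f X i j :
  pseries_diffs (flow_coeff f X i j) = flow_coeff f (f X) i j.
Proof.
apply/funext => k; rewrite /pseries_diffs /flow_coeff iterSr factS natrM.
by rewrite invfM mulrCA mulVKf.
Qed.

Lemma is_derive_flow_re f X i j t :
  is_derive t 1 (flow_re f X i j) (flow_re f (f X) i j t).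
Proof.
rewrite {2}/flow_re -pseries_diffs_flow_coeff.
(* The series converges everywhere, so any point of modulus larger than |t| will do. *)
apply: (@pseries_snd_diffs _ _ (`|t| + 1)); rewrite ?pseries_diffs_flow_coeff.
- exact: is_cvg_flow_coeff.
- exact: is_cvg_flow_coeff.
- exact: is_cvg_flow_coeff.
- by rewrite [ltRHS]ger0_norm ?addr_ge0// ltrDl.
Qed.

(* [semigroup H L] is convertible to [flow (lindblad H L)]. *)
Definition flow f t X : 'M[R[i]]_n.+1 :=
  limn (series (fun k => (t%:C ^+ k / k`!%:R)%C *: iter k f X)).

Lemma iterZ f (a : R[i]) k X : iter k f (a *: X) = a *: iter k f X.
Proof. by elim: k => //= k ->; rewrite linearZ. Qed.

Lemma flow_cvg f t X :
  series (fun k => (t%:C ^+ k / k`!%:R)%C *: iter k f X) @ \oo -->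
  \matrix_(i, j) (flow_re f X i j t +i* flow_re f (- 'i%C *: X) i j t)%C.
Proof.
apply/cvg_matrixP => i j; rewrite mxE; apply/cvg_complexP => /=.
have coeE k : (t%:C ^+ k / k`!%:R)%C = (t ^+ k / k`!%:R)%:C%C.
  by rewrite rmorphM fmorphV rmorphXn rmorph_nat.
have ReZ (r : R) (z : R[i]) : complex.Re (r%:C%C * z) = complex.Re z * r.
  by case: z => a b; simpc; rewrite mulrC.
have ImRe (x : R[i]) : complex.Im x = complex.Re (- 'i%C * x).
  by case: x => ? ?; simpc.
split.
- rewrite [X in X @ _ --> _](_ : _ = pseries (flow_coeff f X i j) t).
    exact: is_cvg_flow_coeff.
  apply/funext => k; rewrite /pseries /series /= summxE raddf_sum.
  apply: eq_bigr => l _; rewrite mxE coeE /= ReZ /flow_coeff; ring.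
- rewrite [X in X @ _ --> _](_ : _ = pseries (flow_coeff f (- 'i%C *: X) i j) t).
    exact: is_cvg_flow_coeff.
  apply/funext => k; rewrite /pseries /series /= summxE raddf_sum.
  apply: eq_bigr => l _; rewrite mxE coeE /= ImRe mulrCA ReZ /flow_coeff iterZ mxE.
  ring.
Qed.

Lemma flowE f t X i j :
  flow f t X i j = (flow_re f X i j t +i* flow_re f (- 'i%C *: X) i j t)%C.
Proof.
by rewrite /flow (cvg_lim (@norm_hausdorff _ _) (@flow_cvg f t X)) mxE.
Qed.

End LinearFlow.

(** * Damped scalar equations and Euler's formula *)

Lemma damped_cvg0 (R : realType) (nu : R) (V dV w : R -> R) : 0 < nu ->
  (forall t : R, is_derive t (1 : R) V (dV t)) -> (forall t, 0 <= V t) ->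
  (forall t, dV t <= - nu * V t + w t) ->
  w t @[t --> +oo] --> 0 -> V t @[t --> +oo] --> 0.
Proof.
move=> nu0 derV V0 dVle w0; apply/cvgrPdist_lt => e e0.
pose h := e / 2; have h0 : 0 < h by rewrite /h divr_gt0.
have [T [_ wT]] : \forall t \near +oo, w t <= nu * h.
  have /cvgrPdist_lt/(_ (nu * h)) := w0; rewrite mulr_gt0// => /(_ isT).
  apply: filterS => t; rewrite sub0r normrN => /ltW; exact: le_trans (ler_norm _).
(* Integrating factor: once w <= nu h, the inequality reads (V - h)' <= - nu (V - h), so [G] no
   longer increases. *)
pose G (t : R) := expR (nu * t) * (V t - h).
have derG (t : R) :
    is_derive t (1 : R) G (expR (nu * t) * (nu * (V t - h) + dV t)).
  have dl : is_derive t (1 : R) (fun s : R => nu * s) nu.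
    have := is_deriveZ nu (is_derive_id t (1 : R)).
    by rewrite /GRing.scale /= mulr1.
  have d1 := is_derive1_comp (is_derive_expR (nu * t)) dl.
  have d2 := is_deriveB (derV t) (is_derive_cst h t (1 : R)).
  have := is_deriveM d1 d2; rewrite /GRing.scale /= => d3.
  by apply: (is_derive_eq d3); rewrite !fctE /=; ring.
have Gle (t : R) : T + 1 <= t -> G t <= G (T + 1).
  apply: (@ler0_derive1_nincry _ G (T + 1)) => //.
  - move=> x; rewrite in_itv /= andbT => xT; rewrite derive1E.
    rewrite (@derive_val _ _ _ _ _ _ _ (derG x)) pmulr_rle0 ?expR_gt0//.
    have := dVle x; have := wT x; rewrite (lt_trans _ xT) ?ltrDl// => /(_ isT) wx dVx.
    have -> : 0 = nu * (V x - h) + (- nu * V x + nu * h) by ring.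
    by rewrite lerD2l (le_trans dVx)// lerD2l.
  - apply: derivable_within_continuous => x _; exact: (@ex_derive _ _ _ _ _ _ _ (derG x)).
near=> t.
have tT : T + 1 <= t by near: t; apply: nbhs_pinfty_ge; rewrite num_real.
have Gt := Gle _ tT.
rewrite sub0r normrN ger0_norm//.
have V_lt : V t - h < h.
  rewrite -(ltr_pM2l (expR_gt0 (nu * t))) -/(G t) (le_lt_trans Gt)//.
  (* It remains to have G (T + 1) / h < exp (nu t), and the linear lower bound 1 + nu t of the
     exponential already exceeds this constant for large t. *)
  rewrite -ltr_pdivrMr// (lt_le_trans _ (expR_ge1Dx _))//.
  rewrite -ltrBlDl -ltr_pdivrMl//.
  near: t; apply: nbhs_pinfty_gt; rewrite num_real//.
by move: V_lt; rewrite ltrBlDr /h -splitr.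
Unshelve. all: by end_near. Qed.

Lemma sqr_cvg0 (R : realType) (x V : R -> R) :
  (forall t, x t ^+ 2 <= V t) ->
  V t @[t --> +oo] --> 0 -> x t @[t --> +oo] --> 0.
Proof.
move=> xV /cvgrPdist_lt V0; apply/cvgrPdist_lt => e e0.
apply: (filterS _ (V0 (e ^+ 2) _)); last by rewrite exprn_gt0.
move=> t; rewrite !sub0r !normrN => Ve.
rewrite -(@ltr_pXn2r _ 2%N) ?nnegrE ?normr_ge0 ?(ltW e0)// -normrX ger0_norm ?sqr_ge0//.
exact: le_lt_trans (le_trans (xV t) (ler_norm _)) Ve.
Qed.

(* V = x^2 + y^2 satisfies V' <= Re mu V + (hx^2 + hy^2) / (- Re mu) by AM-GM. *)
Lemma complex_damped_cvg0 (R : realType) (a b : R) (x y hx hy : R -> R) : a < 0 ->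
  (forall t : R, is_derive t (1 : R) x (a * x t - b * y t + hx t)) ->
  (forall t : R, is_derive t (1 : R) y (b * x t + a * y t + hy t)) ->
  hx t @[t --> +oo] --> 0 -> hy t @[t --> +oo] --> 0 ->
  x t @[t --> +oo] --> 0 /\ y t @[t --> +oo] --> 0.
Proof.
move=> a0 dx dy hx0 hy0.
pose V (t : R) := x t ^+ 2 + y t ^+ 2.
suff V0 : V t @[t --> +oo] --> 0.
  by split; apply: sqr_cvg0 V0 => t; rewrite /V ?lerDl ?lerDr sqr_ge0.
apply: (@damped_cvg0 _ (- a) _ (fun t => 2 * x t * (a * x t - b * y t + hx t)
   + 2 * y t * (b * x t + a * y t + hy t))
   (fun t => (- a)^-1 * (hx t * hx t + hy t * hy t))).
- by rewrite oppr_gt0.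
- move=> t; have d := is_deriveD (is_deriveX 2%N (dx t)) (is_deriveX 2%N (dy t)).
  by apply: (is_derive_eq d); rewrite /GRing.scale /= !expr1.
- by move=> t; rewrite /V addr_ge0 ?sqr_ge0.
- move=> t; rewrite /V.
  have amgm (u v : R) : 2 * u * v <= - a * u ^+ 2 + (- a)^-1 * v ^+ 2.
    have a' : - a != 0 by rewrite oppr_eq0 lt_eqF.
    rewrite -subr_ge0.
    have -> : - a * u ^+ 2 + (- a)^-1 * v ^+ 2 - 2 * u * v
      = (- a)^-1 * ((- a) * u - v) ^+ 2 by field; rewrite lt_eqF.
    by rewrite mulr_ge0 ?sqr_ge0// invr_ge0 oppr_ge0 ltW.
  have := lerD (amgm (x t) (hx t)) (amgm (y t) (hy t)).
  rewrite -subr_ge0 => amgm_sum; rewrite -subr_ge0.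
  move: amgm_sum; congr (is_true (0 <= _)).
  by move: (- a)^-1 => A; ring.
- have := cvgD (cvgM hx0 hx0) (cvgM hy0 hy0); rewrite mulr0 addr0 => c0.
  have {}c0 := c0 _ _ _.
  have := cvgM (cvg_cst (- a)^-1) (c0 _ _ _); rewrite mulr0; apply.
Qed.

(** Euler's formula term by term: i^k is (-1)^(k/2) for even k and i (-1)^((k-1)/2) for odd k, which
    are the parity factors of [cos_coeff] and [sin_coeff]. *)
Lemma cvg_cis_series (R : realType) (x : R) :
  series (fun k => ('i%C * x%:C%C) ^+ k / k`!%:R) @ \oo --> (cis x : R[i]).
Proof.
have coefE k : ('i%C * x%:C%C) ^+ k / k`!%:R =
    (cos_coeff x k +i* sin_coeff x k)%C :> R[i].
  rewrite exprMn.
  have -> : (k`!%:R : R[i])^-1 = (k`!%:R^-1 : R)%:C%C by rewrite fmorphV rmorph_nat.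
  rewrite /cos_coeff /sin_coeff /= -exprnP.
  have -> : 'i%C ^+ k = (((~~ odd k)%:R * (-1) ^+ k./2) +i*
      ((odd k)%:R * (-1) ^+ k.-1./2))%C :> R[i].
    rewrite -{1}(odd_double_half k) exprD -mul2n exprM sqr_i.
    have -> : (-1) ^+ k./2 = ((-1) ^+ k./2 : R)%:C%C :> R[i].
      by rewrite rmorphXn rmorphN1.
    have [ok|_] := boolP (odd k).
      have -> : k.-1./2 = k./2 by rewrite -[in LHS](odd_double_half k) ok /= doubleK.
      rewrite expr1; move: ((-1) ^+ k./2 : R) => u.
      by apply/eqP; rewrite eq_complex /=; apply/andP; split; apply/eqP; ring.
    rewrite expr0; move: ((-1) ^+ k./2 : R) => u.
    by apply/eqP; rewrite eq_complex /=; apply/andP; split; apply/eqP; ring.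
  by rewrite -rmorphXn; simpc.
apply/cvg_complexP; split => /=.
- rewrite [X in X @ _ --> _](_ : _ = series (cos_coeff x)).
    by rewrite unlock; exact: is_cvg_series_cos_coeff.
  apply/funext => k; rewrite /series /= raddf_sum; apply: eq_bigr => l _.
  by rewrite coefE.
- rewrite [X in X @ _ --> _](_ : _ = series (sin_coeff x)).
    by rewrite unlock; exact: is_cvg_series_sin_coeff.
  apply/funext => k; rewrite /series /= raddf_sum; apply: eq_bigr => l _.
  by rewrite coefE.
Qed.

(** * Decay of the flow on an invariant set *)

Section FlowDecay.
Variables (R : realType) (n : nat) (f : {linear 'M[R[i]]_n.+1 -> 'M[R[i]]_n.+1}).
Implicit Types (X Y : 'M[R[i]]_n.+1) (mu : R[i]).

Lemma is_cvg_flow t X :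
  series (fun k => (t%:C ^+ k / k`!%:R)%C *: iter k f X) @ \oo --> flow f t X.
Proof. by rewrite /flow (cvg_lim (@norm_hausdorff _ _) (@flow_cvg _ _ f t X)); exact: flow_cvg. Qed.

Lemma flow_lin t a X Y : flow f t (a *: X + Y) = a *: flow f t X + flow f t Y.
Proof.
rewrite [LHS]/flow; apply: (cvg_lim (@norm_hausdorff _ _)).
pose S Z := series (fun k => (t%:C ^+ k / k`!%:R)%C *: iter k f Z).
rewrite (_ : series _ = (fun k => a *: S X k + S Y k)); last first.
  apply/funext => k.
  rewrite /S /series /= scaler_sumr -big_split /=; apply: eq_bigr => l _.
  have -> : iter l f (a *: X + Y) = a *: iter l f X + iter l f Y.
    by elim: l => //= l ->; rewrite linearP.
  by rewrite scalerDr !scalerA mulrC.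
apply: cvgD; last exact: is_cvg_flow.
by apply: cvgZ; [exact: cvg_cst|exact: is_cvg_flow].
Qed.

Lemma flow_eigen t X (theta : R) : f X = ('i%C * theta%:C%C) *: X ->
  flow f t X = cis (theta * t) *: X.
Proof.
move=> fX; rewrite /flow; apply: (cvg_lim (@norm_hausdorff _ _)).
rewrite (_ : series _ =
  (fun k => series (fun k => ('i%C * (theta * t)%:C%C) ^+ k / k`!%:R) k *: X)).
  by apply: cvgZ; [exact: cvg_cis_series|exact: cvg_cst].
apply/funext => k; rewrite /series /= scaler_suml; apply: eq_bigr => l _.
have -> : iter l f X = ('i%C * theta%:C%C) ^+ l *: X.
  elim: l => [|l IH]; first by rewrite scale1r.
  by rewrite iterS IH linearZ /= fX scalerA -exprSr.
by rewrite scalerA; congr (_ *: _); rewrite rmorphM /= !exprMn; ring.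
Qed.

(** Each entry z of the flow of [X] satisfies z' = mu z + h, where h is the same entry of the flow
    of f X - mu X. Its real and imaginary parts form the coupled system of [complex_damped_cvg0]. *)
Lemma flow_damped X mu : complex.Re mu < 0 ->
  flow f t (f X - mu *: X) @[t --> +oo] --> (0 : 'M[R[i]]_n.+1) ->
  flow f t X @[t --> +oo] --> (0 : 'M[R[i]]_n.+1).
Proof.
move=> mu0 /cvg_matrixP sig0; apply/cvg_matrixP => i j; rewrite mxE.
have sE : f X = mu *: X + (f X - mu *: X) by rewrite addrC subrK.
move: (f X - mu *: X) sig0 sE => s sig0 sE.
have /cvg_complexP[] := sig0 i j; rewrite mxE /= => hx0 hy0.
have ReMD (a z w : R[i]) : complex.Re (a * z + w) =
    complex.Re a * complex.Re z - complex.Im a * complex.Im z + complex.Re w.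
  by case: a z w => [? ?] [? ?] [? ?].
have ImMD (a z w : R[i]) : complex.Im (a * z + w) =
    complex.Im a * complex.Re z + complex.Re a * complex.Im z + complex.Im w.
  by case: a z w => [? ?] [? ?] [? ?] /=; ring.
have fE t : flow f t (f X) i j = mu * flow f t X i j + flow f t s i j.
  by rewrite sE flow_lin !mxE.
apply/cvg_complexP.
apply: (complex_damped_cvg0 mu0 _ _ hx0 hy0) => t.
- rewrite (_ : (fun t => _) = flow_re f X i j); last first.
    by apply/funext => u; rewrite flowE.
  have d := is_derive_flow_re f X i j t; apply: (is_derive_eq d).
  apply: etrans (ReMD mu (flow f t X i j) (flow f t s i j)).
  by rewrite -fE flowE.
- rewrite (_ : (fun t => _) = flow_re f (- 'i%C *: X) i j); last first.
    by apply/funext => u; rewrite flowE.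
  have d := is_derive_flow_re f (- 'i%C *: X) i j t; apply: (is_derive_eq d).
  apply: etrans (ImMD mu (flow f t X i j) (flow f t s i j)).
  by rewrite -fE flowE linearZ.
Qed.

Let g mu X := f X - mu *: X.

(** The roots of the characteristic polynomial of [f], as a matrix on [mxvec], listed with
    multiplicity; they exist because R[i] is algebraically closed. *)
Lemma annihilating_shifts : exists s : seq R[i], forall X, foldr g X s = 0.
Proof.
pose A := lin_mx f.
have [s sP] := closed_field_poly_normal (char_poly A).
exists s => X.
have foldE (r : seq R[i]) :
    mxvec (foldr g X r) = mxvec X *m horner_mx A (\prod_(z <- r) ('X - z%:P)).
  elim: r => [|z r IH] /=; first by rewrite big_nil rmorph1 mulmx1.
  rewrite big_cons mulrC rmorphM /= mulmxA -IH /g linearB linearZ /=.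
  rewrite rmorphB /= horner_mx_X horner_mx_C mulmxBr mul_mx_scalar.
  by rewrite -(mul_vec_lin f (foldr _ _ _)).
apply: (can_inj mxvecK); rewrite foldE linear0.
have := Cayley_Hamilton A; rewrite sP (monicP (char_poly_monic A)) scale1r => ->.
by rewrite mulmx0.
Qed.

(* In the factorization of the characteristic polynomial, a shift f - mu with
   Re mu >= 0 is injective on W and can be cancelled; the others are undone by
   flow_damped. *)
Lemma flow_decay (W : set 'M[R[i]]_n.+1) :
  (forall X mu, W X -> W (f X - mu *: X)) ->
  (forall X mu, W X -> 0 <= complex.Re mu -> f X = mu *: X -> X = 0) ->
  forall X, W X -> flow f t X @[t --> +oo] --> (0 : 'M[R[i]]_n.+1).
Proof.
move=> Wg Winj; have [s sP] := annihilating_shifts.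
move=> X WX; have {sP} := sP X; elim: s X WX => [|mu s IH] X WX /=.
  move=> ->; rewrite (_ : (fun t => _) = cst 0); first exact: cvg_cst.
  (* Linearity at -1 * 0 + 0 gives flow 0 = - flow 0 + flow 0 = 0. *)
  apply/funext => t; have := flow_lin t (-1) 0 0.
  by rewrite scaler0 addr0 scaleN1r addNr.
have Wfold r : W (foldr g X r) by elim: r => //= a r; exact: Wg.
have [mu0|mu0] := leP 0 (complex.Re mu) => gX.
  apply: IH => //; apply: (Winj _ mu) => //.
  by apply/eqP; rewrite -subr_eq0; apply/eqP.
have fg z Y : f (g z Y) = f (f Y) - z *: f Y by rewrite /g linearB linearZ.
have ggC z z' Y : g z (g z' Y) = g z' (g z Y).
  rewrite {1 3}/g !fg /g; move: (f (f Y)) (f Y) => A B.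
  rewrite !scalerBr !scalerA [z' * z]mulrC !opprB !addrA.
  move: (_ *: Y) (z *: B) (z' *: B) => Z B1 B2.
  by rewrite addrAC [RHS]addrAC [X in X + _]addrAC.
(* The shifts commute, so the outermost one can be moved onto [X]. The induction hypothesis then
   applies to the shifted vector, and [flow_damped] returns to [X]. *)
have gC r : foldr g (g mu X) r = g mu (foldr g X r).
  by elim: r => //= a r ->; exact: ggC.
apply: (flow_damped mu0); apply: IH; first exact: Wg.
by rewrite -/(g mu X) gC.
Qed.

End FlowDecay.

(** * Lindblad generators with a normal jump operator *)

Section HilbertSchmidt.
Variables (R : realType) (n : nat).
Implicit Types A B X Y Z : 'M[R[i]]_n.

Lemma adjmxM (m p q : nat) (A : 'M[R[i]]_(m, p)) (B : 'M[R[i]]_(p, q)) :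
  adjmx (A *m B) = adjmx B *m adjmx A.
Proof. by rewrite /adjmx trmx_mul map_mxM. Qed.

Lemma adjmxK (m p : nat) (A : 'M[R[i]]_(m, p)) : adjmx (adjmx A) = A.
Proof. by apply/matrixP => i j; rewrite !mxE conjCK. Qed.

Lemma adjmxB A B : adjmx (A - B) = adjmx A - adjmx B.
Proof. by apply/matrixP => i j; rewrite !mxE rmorphB. Qed.

Lemma adjmxZ (m p : nat) (a : R[i]) (A : 'M[R[i]]_(m, p)) :
  adjmx (a *: A) = Num.conj a *: adjmx A.
Proof. by apply/matrixP => i j; rewrite !mxE rmorphM. Qed.

Lemma trace_adjmx A : \tr (adjmx A) = Num.conj (\tr A).
Proof. by rewrite /mxtrace rmorph_sum; apply: eq_bigr => i _; rewrite !mxE. Qed.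

Lemma hs_dotZr a X Y : hs_dot X (a *: Y) = a * hs_dot X Y.
Proof. by rewrite /hs_dot -scalemxAr mxtraceZ. Qed.

Lemma hs_dotDr X Y Z : hs_dot X (Y + Z) = hs_dot X Y + hs_dot X Z.
Proof. by rewrite /hs_dot mulmxDr mxtraceD. Qed.

Lemma hs_dotBr X Y Z : hs_dot X (Y - Z) = hs_dot X Y - hs_dot X Z.
Proof. by rewrite hs_dotDr -scaleN1r hs_dotZr mulN1r. Qed.

Lemma hs_dot0r X : hs_dot X 0 = 0.
Proof. by rewrite /hs_dot mulmx0 mxtrace0. Qed.

Lemma hs_dot_sumr X (m : nat) (F : 'I_m -> 'M[R[i]]_n) :
  hs_dot X (\sum_k F k) = \sum_k hs_dot X (F k).
Proof. by rewrite /hs_dot mulmx_sumr raddf_sum. Qed.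

Lemma hs_dotE X Y : hs_dot X Y = \sum_i \sum_j Num.conj (X j i) * Y j i.
Proof.
by rewrite /hs_dot; apply: eq_bigr => i _; rewrite mxE; apply: eq_bigr => j _; rewrite !mxE.
Qed.

Lemma hs_dot_ge0 X : 0 <= hs_dot X X.
Proof.
rewrite hs_dotE; apply: sumr_ge0 => i _; apply: sumr_ge0 => j _.
by rewrite mulrC mul_conjC_ge0.
Qed.

Lemma hs_dot_eq0 X : hs_dot X X = 0 -> X = 0.
Proof.
rewrite hs_dotE => /eqP.
have ge0 i j : 0 <= Num.conj (X j i) * X j i by rewrite mulrC mul_conjC_ge0.
rewrite psumr_eq0 => [/allP X0|i _]; last by apply: sumr_ge0.
apply/matrixP => j i; rewrite mxE.
have := X0 i (mem_index_enum _); rewrite psumr_eq0// => /allP/(_ j (mem_index_enum _)).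
by rewrite mulf_eq0 conjC_eq0 orbb => /eqP.
Qed.

End HilbertSchmidt.

(** * Dissipation identity and peripheral eigenvectors *)

Section NormalLindblad.
Variables (R : realType) (n : nat) (H L : 'M[R[i]]_n).
Hypothesis Hherm : adjmx H = H.
Hypothesis Lnormal : L *m adjmx L = adjmx L *m L.
Implicit Types X Y : 'M[R[i]]_n.

(** For normal [K] the right-hand side is symmetric in [K] and its adjoint, so both commutators with
    [X] have the same norm. [lindblad_eigen] uses this to pass from [L] to its adjoint. *)
Lemma hs_dot_commutator (K X : 'M[R[i]]_n) : K *m adjmx K = adjmx K *m K ->
  hs_dot (K *m X - X *m K) (K *m X - X *m K) =
  \tr (adjmx X *m (adjmx K *m K) *m X) + \tr (adjmx X *m X *m (adjmx K *m K))
  - \tr (adjmx X *m K *m X *m adjmx K) - \tr (adjmx X *m adjmx K *m X *m K).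
Proof.
move=> Knormal.
have trB (A B A' B' : 'M[R[i]]_n) : \tr ((A - B) *m (A' - B')) =
    \tr (A *m A') - \tr (B *m A') - (\tr (A *m B') - \tr (B *m B')).
  by rewrite mulmxBr !mulmxBl !raddfB.
rewrite /hs_dot adjmxB !adjmxM trB.
have -> : \tr (adjmx X *m adjmx K *m (K *m X)) = \tr (adjmx X *m (adjmx K *m K) *m X).
  by rewrite !mulmxA.
have -> : \tr (adjmx K *m adjmx X *m (K *m X)) = \tr (adjmx X *m K *m X *m adjmx K).
  by rewrite -mulmxA mxtrace_mulC !mulmxA.
have -> : \tr (adjmx K *m adjmx X *m (X *m K)) = \tr (adjmx X *m X *m (adjmx K *m K)).
  by rewrite -mulmxA mxtrace_mulC -Knormal !mulmxA.
have -> : \tr (adjmx X *m adjmx K *m (X *m K)) = \tr (adjmx X *m adjmx K *m X *m K).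
  by rewrite !mulmxA.
move: (\tr _) (\tr _) (\tr _) (\tr _) => a b c d; ring.
Qed.

(** The two Hamiltonian traces are real ([h1], [h2]) and carry the factor -i, so they cancel. The
    anticommutator traces are real too ([d1], [d2]), and conjugating the jump term exchanges the two
    mixed traces of [hs_dot_commutator] ([d3]). *)
Lemma hs_dot_lindblad_Re X :
  hs_dot X (lindblad H L X) + Num.conj (hs_dot X (lindblad H L X)) =
  - hs_dot (L *m X - X *m L) (L *m X - X *m L).
Proof.
rewrite hs_dot_commutator// /lindblad hs_dotBr hs_dotDr.
rewrite !hs_dotZr hs_dotBr hs_dotDr /hs_dot.
have h1 : Num.conj (\tr (adjmx X *m (H *m X))) = \tr (adjmx X *m (H *m X)).
  by rewrite -trace_adjmx !adjmxM adjmxK Hherm mulmxA.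
have h2 : Num.conj (\tr (adjmx X *m (X *m H))) = \tr (adjmx X *m (X *m H)).
  by rewrite -trace_adjmx !adjmxM adjmxK Hherm -mulmxA mxtrace_mulC -mulmxA.
have d1 : Num.conj (\tr (adjmx X *m (adjmx L *m L *m X))) = \tr (adjmx X *m (adjmx L *m L) *m X).
  by rewrite -trace_adjmx !adjmxM !adjmxK !mulmxA.
have d2 : Num.conj (\tr (adjmx X *m (X *m (adjmx L *m L)))) = \tr (adjmx X *m X *m (adjmx L *m L)).
  by rewrite -trace_adjmx !adjmxM !adjmxK -mulmxA mxtrace_mulC.
have d3 : Num.conj (\tr (adjmx X *m (L *m X *m adjmx L))) = \tr (adjmx X *m adjmx L *m X *m L).
  by rewrite -trace_adjmx !adjmxM !adjmxK -mulmxA mxtrace_mulC.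
have conjE (p q u x y : R[i]) :
    Num.conj (- 'i%C * (p - q) + u - 2^-1 * (x + y)) =
    - Num.conj 'i%C * (Num.conj p - Num.conj q) + Num.conj u
    - Num.conj 2^-1 * (Num.conj x + Num.conj y).
  by rewrite !(rmorphB, rmorphD, rmorphM, rmorphN).
rewrite conjE h1 h2 d1 d2 d3.
rewrite [adjmx X *m (adjmx L *m L *m X)]mulmxA [adjmx X *m (X *m (_ *m _))]mulmxA.
rewrite [adjmx X *m (L *m X *m _)]mulmxA [adjmx X *m (L *m X)]mulmxA.
have -> : Num.conj ('i%C : R[i]) = - 'i%C by apply/eqP; rewrite eq_complex /= oppr0 !eqxx.
have -> : Num.conj (2^-1 : R[i]) = 2^-1 by rewrite fmorphV rmorph_nat.
move: (\tr _) (\tr _) (\tr _) (\tr _) => a b c d.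
move: (\tr _) (\tr _) => u v.
by field.
Qed.

Lemma lindblad_commute X : L *m X = X *m L -> adjmx L *m X = X *m adjmx L ->
  lindblad H L X = - 'i%C *: (H *m X - X *m H).
Proof.
move=> LX LsX; rewrite /lindblad LX.
have -> : adjmx L *m L *m X = X *m (adjmx L *m L).
  by rewrite -mulmxA LX mulmxA LsX mulmxA.
rewrite -mulmxA Lnormal; set D := X *m _; clearbody D.
by apply/matrixP => i j; rewrite !mxE; field.
Qed.

Lemma lindblad_eigen X (mu : R[i]) :
  lindblad H L X = mu *: X -> 0 <= complex.Re mu ->
  [/\ L *m X = X *m L, adjmx L *m X = X *m adjmx L,
      H *m X - X *m H = ('i%C * mu) *: X & X != 0 -> complex.Re mu = 0].
Proof.
move=> fX mu0; have N0 := hs_dot_ge0 X.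
have NC : Num.conj (hs_dot X X) = hs_dot X X by apply/CrealP; exact: ger0_real.
have muE : mu + Num.conj mu = (2 * complex.Re mu)%:C%C.
  by case: (mu) => x y; apply/eqP; rewrite eq_complex /= subrr eqxx andbT; apply/eqP; ring.
have := hs_dot_lindblad_Re X; rewrite fX hs_dotZr rmorphM /= NC -mulrDl muE => dis.
(* The identity [dis] equates this nonnegative number with minus a squared norm, so both sides
   vanish. *)
have le0 : 0 <= (2 * complex.Re mu)%:C%C * hs_dot X X.
  by rewrite mulr_ge0// ler0c mulr_ge0.
have C0 : hs_dot (L *m X - X *m L) (L *m X - X *m L) = 0.
  apply/eqP; rewrite eq_le hs_dot_ge0 andbT -oppr_ge0 -dis//.
have LX : L *m X = X *m L by apply/eqP; rewrite -subr_eq0; apply/eqP/hs_dot_eq0.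
have LsX : adjmx L *m X = X *m adjmx L.
  apply/eqP; rewrite -subr_eq0; apply/eqP/hs_dot_eq0.
  rewrite -C0 !hs_dot_commutator// adjmxK ?Lnormal//.
  move: (\tr _) (\tr _) (\tr _) (\tr _) => u v w z; ring.
split=> //.
  move: fX; rewrite lindblad_commute//.
  rewrite -scalerA => <-; rewrite scalerA.
  have -> : 'i%C * - 'i%C = 1 :> R[i] by rewrite mulrN -expr2 sqr_i opprK.
  by rewrite scale1r.
move=> X0; move: dis; rewrite C0 oppr0 => /eqP; rewrite mulf_eq0 => /orP[|/eqP /hs_dot_eq0 X1].
  by rewrite eq_complex /= mulf_eq0 pnatr_eq0 /= eqxx andbT => /eqP.
by rewrite X1 eqxx in X0.
Qed.

(** [X] is a left eigenvector: by cyclicity of the trace and the commutation relations all three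
    dissipative terms become the trace of X^* L^* L Y, with total weight 1 - 1/2 - 1/2 = 0, and only
    the Hamiltonian term is left. *)
Lemma hs_dot_lindblad X Y (theta : R) :
  L *m X = X *m L -> adjmx L *m X = X *m adjmx L ->
  H *m X - X *m H = - theta%:C%C *: X ->
  hs_dot X (lindblad H L Y) = 'i%C * theta%:C%C * hs_dot X Y.
Proof.
move=> LX LsX HX.
have XsL : adjmx X *m L = L *m adjmx X.
  by rewrite -[L]adjmxK -!adjmxM LsX.
have XsLs : adjmx X *m adjmx L = adjmx L *m adjmx X by rewrite -!adjmxM LX.
have XsH : adjmx X *m H - H *m adjmx X = - theta%:C%C *: adjmx X.
  rewrite -{1 2}Hherm -!adjmxM -adjmxB HX adjmxZ rmorphN /=.
  by congr (- _ *: _); apply: conj_Creal; rewrite complex_real.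
rewrite /lindblad hs_dotBr hs_dotDr !hs_dotZr hs_dotBr hs_dotDr.
have -> : hs_dot X (L *m Y *m adjmx L) = \tr (adjmx X *m (adjmx L *m L *m Y)).
  rewrite /hs_dot [adjmx X *m _]mulmxA mxtrace_mulC [adjmx X *m (L *m Y)]mulmxA.
  by rewrite [adjmx L *m (_ *m _)]mulmxA [adjmx L *m (_ *m _)]mulmxA -XsLs !mulmxA.
have -> : hs_dot X (Y *m (adjmx L *m L)) = \tr (adjmx X *m (adjmx L *m L *m Y)).
  rewrite /hs_dot [adjmx X *m _]mulmxA mxtrace_mulC [adjmx L *m L *m (_ *m _)]mulmxA.
  by rewrite -[adjmx L *m L *m adjmx X]mulmxA -XsL [adjmx L *m (_ *m _)]mulmxA -XsLs !mulmxA.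
have -> : hs_dot X (H *m Y) = - theta%:C%C * hs_dot X Y + hs_dot X (Y *m H).
  rewrite /hs_dot mulmxA; have -> : adjmx X *m H = - theta%:C%C *: adjmx X + H *m adjmx X.
    by rewrite -XsH subrK.
  rewrite mulmxDl -scalemxAl mxtraceD mxtraceZ; congr (_ + _).
  by rewrite -mulmxA mxtrace_mulC mulmxA.
rewrite /hs_dot; move: (\tr _) (\tr _) (\tr _) => u v w.
by field.
Qed.

End NormalLindblad.

(** * Attractor space and asymptotics from an orthonormal family of attractors *)

Section Attractors.
Variables (R : realType) (n : nat) (H L : 'M[R[i]]_n.+1).
Variables (Xs : seq 'M[R[i]]_n.+1) (th : seq R).
Hypothesis Hherm : adjmx H = H.
Hypothesis Lnormal : L *m adjmx L = adjmx L *m L.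
Hypothesis Xs_on : hs_orthonormal Xs.
Hypothesis Xs_L : forall j : 'I_(size Xs), L *m Xs`_j = Xs`_j *m L.
Hypothesis Xs_Ls : forall j : 'I_(size Xs), adjmx L *m Xs`_j = Xs`_j *m adjmx L.
Hypothesis Xs_H : forall j : 'I_(size Xs),
  H *m Xs`_j - Xs`_j *m H = - (th`_j)%:C%C *: Xs`_j.
Hypothesis Xs_span : forall X (z : R[i]), L *m X = X *m L ->
  adjmx L *m X = X *m adjmx L -> H *m X - X *m H = z *: X -> X \in <<Xs>>%VS.
Implicit Types (X Y rho : 'M[R[i]]_n.+1) (j : 'I_(size Xs)).

Let f := lindblad H L.

Lemma hs_dot_basis j j' : hs_dot Xs`_j Xs`_j' = (j == j')%:R.
Proof. by rewrite Xs_on. Qed.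

Lemma hs_dot_comb (a : 'I_(size Xs) -> R[i]) j :
  hs_dot Xs`_j (\sum_(k < size Xs) a k *: Xs`_k) = a j.
Proof.
rewrite hs_dot_sumr (bigD1 j)//= hs_dotZr hs_dot_basis eqxx mulr1 big1 ?addr0// => k kj.
by rewrite hs_dotZr hs_dot_basis eq_sym (negPf kj) mulr0.
Qed.

Lemma free_basis : free Xs.
Proof.
apply/(@freeP _ _ _ (in_tuple Xs)) => a a0 j.
by rewrite -(hs_dot_comb a j) (_ : \sum_(k < size Xs) _ = 0) ?hs_dot0r// -a0.
Qed.

Lemma comb_in_span (a : 'I_(size Xs) -> R[i]) : \sum_(k < size Xs) a k *: Xs`_k \in <<Xs>>%VS.
Proof. by apply: rpred_sum => k _; rewrite rpredZ// memv_span// mem_nth. Qed.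

Lemma span_expansion X : X \in <<Xs>>%VS -> X = \sum_(k < size Xs) hs_dot Xs`_k X *: Xs`_k.
Proof.
move=> XXs; have XE := @coord_span _ _ _ (in_tuple Xs) X XXs.
rewrite {1}XE; apply: eq_bigr => k _; congr (_ *: _).
by rewrite {2}XE hs_dot_comb.
Qed.

Lemma lindblad_basis j : f Xs`_j = ('i%C * (th`_j)%:C%C) *: Xs`_j.
Proof.
by rewrite /f lindblad_commute// Xs_H scalerA mulrNN.
Qed.

Lemma hs_dot_basis_lindblad j X :
  hs_dot Xs`_j (f X) = 'i%C * (th`_j)%:C%C * hs_dot Xs`_j X.
Proof. exact: hs_dot_lindblad. Qed.

Lemma leigenspaceP (l : R[i]) X :
  (X \in passmx.leigenspace (linfun f) l) = (f X == l *: X).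
Proof.
rewrite /passmx.leigenspace memv_ker add_lfunE opp_lfunE scale_lfunE id_lfunE lfunE.
by rewrite subr_eq0.
Qed.

Lemma eigen_in_span X (l : R[i]) : complex.Re l = 0 -> f X = l *: X -> X \in <<Xs>>%VS.
Proof.
move=> l0 fX; have [|LX LsX HX _] := lindblad_eigen Hherm Lnormal fX; first by rewrite l0.
exact: (Xs_span LX LsX HX).
Qed.

(** Pairing with a basis element on which [X] has a nonzero coefficient identifies [l]. Thus only
    finitely many imaginary numbers are eigenvalues. *)
Lemma eigen_value X (l : R[i]) : complex.Re l = 0 -> f X = l *: X -> X != 0 ->
  exists j, l = 'i%C * (th`_j)%:C%C.
Proof.
move=> l0 fX X0; have XE := span_expansion (eigen_in_span l0 fX).
have [j Xj|X_0] := pickP (fun j => hs_dot Xs`_j X != 0).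
  exists j; apply: (mulIf Xj).
  by rewrite -hs_dot_basis_lindblad fX hs_dotZr.
case/eqP: X0; rewrite XE big1// => j _.
by have := X_0 j => /negbFE /eqP ->; rewrite scale0r.
Qed.

Lemma attractor_spaceE : attractor_space H L = <<Xs>>%VS.
Proof.
rewrite /attractor_space; set A := [set l : R[i] | complex.Re l = 0].
set E := passmx.leigenspace (linfun (lindblad H L)).
(* The sum defining the attractor space runs over its [finite_support]; membership there is
   described by [in_finite_support] once the set of nontrivial eigenspaces is known to be finite. *)
have finA : finite_set (A `&` E @^-1` [set~ 0%VS]).
  apply: (@sub_finite_set _ _
    ((fun j : 'I_(size Xs) => 'i%C * (th`_j)%:C%C) @` [set: 'I_(size Xs)])).
    move=> l /= [lA El].
    have [X XE X0] : exists2 X, X \in E l & X != 0.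
      exists (vpick (E l)); first exact: memv_pick.
      by rewrite vpick0; apply/eqP.
    move: XE; rewrite leigenspaceP => /eqP fX.
    by have [j ->] := eigen_value lA fX X0; exists j.
  exact: finite_image.
apply/eqP; rewrite eqEsubv; apply/andP; split.
  rewrite big_seq; apply: (big_ind (fun V : {vspace _} => V <= <<Xs>>)%VS).
  - exact: sub0v.
  - by move=> U V UX VX; rewrite subv_add UX.
  - move=> l; rewrite in_finite_support// inE => -[lA _].
    apply/subvP => X; rewrite leigenspaceP => /eqP; exact: eigen_in_span.
apply/span_subvP => X XXs.
have iX : (index X Xs < size Xs)%N by rewrite index_mem.
have fX := lindblad_basis (Ordinal iX); rewrite /= nth_index// in fX.
set l := 'i%C * _ in fX.
have lA : A l by rewrite /A /= /l mul0r mul1r subrr.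
have XE : X \in E l by rewrite leigenspaceP; apply/eqP.
have [X0|X0] := eqVneq X 0; first by rewrite X0 mem0v.
have lS : l \in finite_support 0%VS A E.
  rewrite in_finite_support// inE; split=> //= E0.
  by move: XE; rewrite E0 memv0 (negPf X0).
suff /subvP/(_ X XE) : (E l <= \big[addv/0%VS]_(i <- finite_support 0%VS A E) E i)%VS by [].
elim: (finite_support _ _ _) lS => // l' r IH; rewrite big_cons inE => /predU1P[<-|lr].
  exact: addvSl.
exact: subv_trans (IH lr) (addvSr _ _).
Qed.


Lemma attractor_eigenbasis_basis (lambda : seq R[i]) : size lambda = size Xs ->
  (forall j, lambda`_j = 'i%C * (th`_j)%:C%C) -> attractor_eigenbasis H L Xs lambda.
Proof.
move=> sz lamE; split=> // [|j jX].
  by rewrite /basis_of attractor_spaceE eqxx free_basis.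
by rewrite (lamE (Ordinal jX)); exact: (lindblad_basis (Ordinal jX)).
Qed.

Definition attractor_comb (a : nat -> R[i]) (t : R) : 'M[R[i]]_n.+1 :=
  \sum_(k < size Xs) (cis (th`_k * t) * a k) *: Xs`_k.

Lemma semigroup_comb (a : nat -> R[i]) t :
  semigroup H L t (attractor_comb a 0) = attractor_comb a t.
Proof.
rewrite -[LHS]/(flow f t (attractor_comb a 0)).
have flowZ c X : flow f t (c *: X) = c *: flow f t X.
  have f0 : flow f t 0 = 0.
    by have := flow_lin f t (-1) 0 0; rewrite scaler0 addr0 scaleN1r addNr.
  by rewrite -[c *: X]addr0 flow_lin f0 addr0.
rewrite /attractor_comb.
rewrite (big_morph (flow f t) (id1 := 0) (op1 := +%R)); last first.
- by rewrite -[in LHS](scale0r 0) flowZ scale0r.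
- by move=> X Y; rewrite -[X in X + Y]scale1r flow_lin scale1r.
apply: eq_bigr => k _; rewrite flowZ (flow_eigen _ (lindblad_basis k)) scalerA.
by rewrite mulr0 /cis cos0 sin0 mul1r mulrC.
Qed.

Lemma semigroup_attracted rho :
  semigroup H L t rho - attractor_comb (fun k => hs_dot Xs`_k rho) t @[t --> +oo]
    --> (0 : 'M[R[i]]_n.+1).
Proof.
(* The orthogonal projection of [rho] onto the attractors, since every phase is 1 at time 0; its
   evolution is exactly the subtracted trajectory. *)
pose rho1 := attractor_comb (fun k => hs_dot Xs`_k rho) 0.
pose W := [set X : 'M[R[i]]_n.+1 | forall j, hs_dot Xs`_j X = 0].
have cis0 : cis 0 = 1 :> R[i] by rewrite /cis cos0 sin0.
rewrite (_ : (fun t => _) = fun t => flow f t (rho - rho1)); last first.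
  apply/funext => t; rewrite -semigroup_comb -/rho1.
  have -> : rho - rho1 = (-1) *: rho1 + rho by rewrite scaleN1r addrC.
  by rewrite flow_lin scaleN1r addrC.
apply: (@flow_decay _ _ _ W).
- move=> X mu WX j; rewrite hs_dotBr hs_dotZr [hs_dot _ (_ X)]hs_dot_basis_lindblad.
  by rewrite WX !mulr0 subrr.
- move=> X mu WX mu0 fX; have [LX LsX HX _] := lindblad_eigen Hherm Lnormal fX mu0.
  rewrite (span_expansion (Xs_span LX LsX HX)) big1// => j _.
  by rewrite WX scale0r.
- move=> j; rewrite hs_dotBr /rho1 /attractor_comb.
  by rewrite hs_dot_comb mulr0 cis0 mul1r subrr.
Qed.

(** Pairing the difference with the j-th attractor gives a phase times a_j - b_j. Its modulus is
    constant in time, so it can tend to 0 only by being 0. *)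
Lemma attractor_comb_inj (a b : nat -> R[i]) :
  attractor_comb a t - attractor_comb b t @[t --> +oo] --> (0 : 'M[R[i]]_n.+1) ->
  forall j, a j = b j.
Proof.
move=> /cvg_matrixP ab0 j; apply/eqP; rewrite -subr_eq0; apply/eqP.
have d0 : hs_dot Xs`_j (attractor_comb a t - attractor_comb b t) @[t --> +oo] --> (0 : R[i]).
  rewrite (_ : (fun t => _) = fun t => \sum_i \sum_k
      Num.conj (Xs`_j k i) * (attractor_comb a t - attractor_comb b t) k i); last first.
    by apply/funext => t; rewrite hs_dotE.
  rewrite [X in _ --> X](_ : 0 = \sum_(i < n.+1) \sum_(k < n.+1) (0 : R[i])); last first.
    by rewrite big1// => i _; rewrite big1.
  apply: cvg_big => [|i _]; first exact: add_continuous.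
  apply: cvg_big => [|k _]; first exact: add_continuous.
  rewrite -[X in _ --> X](mulr0 (Num.conj (Xs`_j k i))).
  apply: cvgM; first exact: cvg_cst.
  by have := ab0 k i; rewrite mxE.
have dE t : hs_dot Xs`_j (attractor_comb a t - attractor_comb b t) =
    cis (th`_j * t) * (a j - b j).
  by rewrite hs_dotBr /attractor_comb !hs_dot_comb mulrBr.
have ncis (x : R) : `|cis x : R[i]| = 1 by rewrite normc_def /= cos2Dsin2 sqrtr1.
have : `|a j - b j| @[t --> (+oo : set_system R)] --> (0 : R[i]).
  rewrite -[X in _ --> X](@normr0 _ R[i]).
  rewrite (_ : (fun t => _) =
    fun t => `|hs_dot Xs`_j (attractor_comb a t - attractor_comb b t)|); last first.
    by apply/funext => t; rewrite dE normrM ncis mul1r.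
  exact: cvg_norm.
move/(cvg_lim (@norm_hausdorff _ _)); rewrite lim_cst; last exact: norm_hausdorff.
by move/eqP; rewrite normr_eq0 => /eqP.
Qed.

(** A trajectory inside the attractor space is determined by its coefficients at time 0. If it
    attracts the orbit of [rho], it differs from the projected trajectory by something tending to 0,
    and [attractor_comb_inj] makes the coefficients equal. *)
Lemma asymptotic_dynamicsP rho (rho_as : R -> 'M[R[i]]_n.+1) :
  asymptotic_dynamics H L rho rho_as <->
  forall t : R, 0 <= t -> rho_as t = attractor_comb (fun k => hs_dot Xs`_k rho) t.
Proof.
split=> [[rho_in rho_sg rho_lim]|rhoE].
  pose a k := hs_dot Xs`_k (rho_as 0).
  have aE t : 0 <= t -> rho_as t = attractor_comb a t.
    move=> t0; rewrite rho_sg// -semigroup_comb; congr semigroup.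
    rewrite attractor_spaceE in rho_in.
    rewrite [LHS](span_expansion (rho_in 0 (lexx _))) /attractor_comb.
    by apply: eq_bigr => k _; rewrite mulr0 /cis cos0 sin0 mul1r.
  have ab j : a j = hs_dot Xs`_j rho.
    apply: (@attractor_comb_inj a (fun k => hs_dot Xs`_k rho)).
    have c1 := semigroup_attracted rho.
    have c2 : semigroup H L t rho - rho_as t @[t --> +oo] --> (0 : 'M[R[i]]_n.+1).
      by apply/norm_cvg0P.
    have c3 : (semigroup H L t rho - attractor_comb (fun k => hs_dot Xs`_k rho) t)
        - (semigroup H L t rho - rho_as t) @[t --> +oo] --> (0 - 0 : 'M[R[i]]_n.+1).
      exact: cvgB.
    rewrite subrr in c3; apply: cvg_trans c3; apply: near_eq_cvg; near=> t.
    have -> : rho_as t = attractor_comb a t.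
      by apply: aE; near: t; apply: nbhs_pinfty_ge; rewrite num_real.
    move: (semigroup _ _ _ _) (attractor_comb _ _) (attractor_comb _ _) => S B C.
    by rewrite opprB addrC addrA subrK.
  move=> t t0; rewrite aE// /attractor_comb; apply: eq_bigr => k _.
  by rewrite ab.
split=> [t t0|t t0|].
- by rewrite attractor_spaceE rhoE// comb_in_span.
- by rewrite !rhoE// semigroup_comb.
- apply/norm_cvg0P; apply: cvg_trans (semigroup_attracted rho).
  apply: near_eq_cvg; near=> t; rewrite rhoE//.
Unshelve. all: by end_near. Qed.

End Attractors.

(** * The two-qubit model *)

Lemma evolution_diag (R : realType) (n : nat) (h : 'I_n.+1 -> R) (t : R) :
  evolution (diag_mx (\row_j (h j)%:C%C)) t = diag_mx (\row_j cis (- (t * h j))).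
Proof.
rewrite /evolution /expmx; apply: (cvg_lim (@norm_hausdorff _ _)).
set A := _ *: diag_mx _.
pose x j := - (t * h j).
have expA k : A ^+ k = diag_mx (\row_j ('i%C * (x j)%:C%C) ^+ k).
  elim: k => [|k IH].
    by apply/matrixP => i j; rewrite expr0 !mxE expr0.
  rewrite exprS IH -mulmxE /A -scalemxAl mul_diag_mx.
  apply/matrixP => i j; rewrite !mxE.
  have [->|_] := eqVneq i j; last by rewrite !mulr0n !mulr0.
  rewrite !mulr1n exprS; move: (_ ^+ k) => u.
  (* The imaginary unit in [evolution] is [Num.imaginary], not ['i%C]. *)
  by rewrite /x rmorphN rmorphM /= -complexiE; ring.
apply/cvg_matrixP => i j; rewrite !mxE.
rewrite (_ : (fun k => _) = (fun k =>
  series (fun l => ('i%C * (x i)%:C%C) ^+ l / l`!%:R) k *+ (i == j))).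
  have [->|_] := eqVneq i j; last by rewrite mulr0n; exact: cvg_cst.
  by rewrite mulr1n; exact: cvg_cis_series.
apply/funext => k; rewrite /series /= summxE -sumrMnl; apply: eq_bigr => l _.
by rewrite mxE expA !mxE mulrnAr mulrC.
Qed.

Local Notation o4 k := (@Ordinal 4 k isT).

Lemma mulmx4E (K : pzRingType) (m n : nat) (A : 'M[K]_(m, 4)) (B : 'M[K]_(4, n)) i j :
  (A *m B) i j = A i (o4 0) * B (o4 0) j + A i (o4 1) * B (o4 1) j
               + A i (o4 2) * B (o4 2) j + A i (o4 3) * B (o4 3) j.
Proof.
rewrite mxE !big_ord_recl big_ord0 addr0 !addrA.
by do ![congr (_ + _)]; congr (A i _ * B _ j); apply: val_inj.
Qed.

(** The four indices are closed terms, so entries given by [nth] reduce by computation in each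
    case. *)
Lemma ord4_ind (P : 'I_4 -> Prop) :
  P (o4 0) -> P (o4 1) -> P (o4 2) -> P (o4 3) -> forall i, P i.
Proof.
move=> P0 P1 P2 P3 [[|[|[|[|//]]]] p].
- by rewrite (_ : Ordinal p = o4 0)//; exact: val_inj.
- by rewrite (_ : Ordinal p = o4 1)//; exact: val_inj.
- by rewrite (_ : Ordinal p = o4 2)//; exact: val_inj.
- by rewrite (_ : Ordinal p = o4 3)//; exact: val_inj.
Qed.

Section Qubits.
Variables (R : realType) (E0 E1 phi : R).
Local Notation C := R[i].

Lemma conj_real_complex (x : R) : Num.conj (x%:C%C : C) = x%:C%C.
Proof. by apply: conj_Creal; rewrite complex_real. Qed.

Lemma conj_isqrt2 : Num.conj (isqrt2 : C) = isqrt2.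
Proof. exact: conj_real_complex. Qed.

Lemma isqrt2_sqr : isqrt2 * isqrt2 = 2^-1 :> C.
Proof.
by rewrite /isqrt2 -rmorphM -invfM -expr2 sqr_sqrtr// fmorphV rmorph_nat.
Qed.

Lemma cisD (x y : R) : cis (x + y) = cis x * cis y :> C.
Proof.
by rewrite /cis cosD sinD; apply/eqP; rewrite eq_complex /= [_ + sin x * _]addrC !eqxx.
Qed.

Lemma conj_cis (x : R) : Num.conj (cis x) = cis (- x) :> C.
Proof. by rewrite /cis cosN sinN. Qed.

Lemma cis_conj (x : R) : cis x * cis (- x) = 1 :> C.
Proof. by rewrite -cisD subrr /cis cos0 sin0. Qed.

Definition level (j : 'I_4) : R := nth 0 [:: E0 + E0; E0 + E1; E0 + E1; E1 + E1] j.

Lemma ham_diag : ham E0 E1 = diag_mx (\row_j (level j)%:C%C).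
Proof.
apply/matrixP => i j; rewrite !mxE /level.
by elim/ord4_ind: i; elim/ord4_ind: j;
  rewrite /= ?mulr1n ?mulr0n ?rmorphD; ring.
Qed.

Lemma ham_hermitian : adjmx (ham E0 E1) = ham E0 E1 :> 'M[C]_4.
Proof.
rewrite ham_diag; apply/matrixP => i j; rewrite !mxE rmorphMn /= conj_real_complex.
by rewrite eq_sym; case: eqVneq => // ->.
Qed.

Local Notation T := (T1 phi).

Lemma T1_unitary : adjmx T *m T = 1%:M :> 'M[C]_4.
Proof.
have hs : isqrt2 * isqrt2 = 2^-1 :> C := isqrt2_sqr.
have he : cis (- phi) * isqrt2 * (cis phi * isqrt2) = 2^-1 :> C.
  by rewrite mulrACA hs [cis (- phi) * _]mulrC cis_conj mul1r.
have h1 : 2^-1 + 2^-1 = 1 :> C by field.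
apply/matrixP => i j; rewrite mulmx4E !mxE.
elim/ord4_ind: i; elim/ord4_ind: j; rewrite /=.
all: rewrite ?rmorphN ?rmorphM /= ?conj_isqrt2 ?conj_cis ?conjC0 ?conjC1.
all: rewrite ?(mulr0, mul0r, mulr1, mul1r, addr0, add0r, mulr0n, mulr1n)//.
all: by rewrite ?(mulrN, mulNr, opprK) hs he ?subrr ?h1.
Qed.

Lemma T1_unitary_r : T *m adjmx T = 1%:M :> 'M[C]_4.
Proof. exact: mulmx1C T1_unitary. Qed.

(** [T1] mixes only the second and third basis vectors, where [d] is scalar. This applies to the
    Hamiltonian and its exponential because |01> and |10> have the same energy. *)
Lemma diag_T1_comm (d : 'rV[C]_4) : d 0 (o4 1) = d 0 (o4 2) ->
  diag_mx d *m T = T *m diag_mx d.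
Proof.
move=> d12; apply/matrixP => i j; rewrite mul_diag_mx mul_mx_diag !mxE.
by elim/ord4_ind: i; elim/ord4_ind: j; rewrite /= ?mulr0 ?mul0r ?d12// mulrC.
Qed.

Lemma ket_T1 :
  [/\ ket 0 0 = T *m delta_mx (o4 0) 0 :> 'cV[C]_4,
      psi1 phi = T *m delta_mx (o4 1) 0,
      psi2 phi = T *m delta_mx (o4 2) 0 &
      ket 1 1 = T *m delta_mx (o4 3) 0 :> 'cV[C]_4].
Proof.
split; apply/matrixP => i j; rewrite mulmx4E !mxE !ord1;
  by elim/ord4_ind: i; rewrite /= ?mulr1n ?mulr0n; ring.
Qed.

End Qubits.

(** * Change of basis by T1 *)

Section T1Conjugation.
Variables (R : realType) (E0 E1 phi : R).
Local Notation C := R[i].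
Local Notation T := (T1 phi).
Implicit Types X Y : 'M[C]_4.

Definition t1conj Y : 'M[C]_4 := T *m Y *m adjmx T.

Lemma t1conj_is_linear : linear t1conj.
Proof. by move=> z X Y; rewrite /t1conj mulmxDr mulmxDl -scalemxAr -scalemxAl. Qed.

HB.instance Definition _ := GRing.isLinear.Build C 'M[C]_4 'M[C]_4 *:%R t1conj
  t1conj_is_linear.

Lemma t1conjK Y : adjmx T *m t1conj Y *m T = Y.
Proof.
by rewrite /t1conj !mulmxA T1_unitary mul1mx -mulmxA T1_unitary mulmx1.
Qed.

Lemma t1conjVK X : t1conj (adjmx T *m X *m T) = X.
Proof.
by rewrite /t1conj !mulmxA T1_unitary_r mul1mx -mulmxA T1_unitary_r mulmx1.
Qed.

Lemma t1conj_inj : injective t1conj.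
Proof. by move=> X Y XY; rewrite -(t1conjK X) XY t1conjK. Qed.

Lemma t1conjM X Y : t1conj (X *m Y) = t1conj X *m t1conj Y.
Proof.
rewrite /t1conj -[RHS]mulmxA [adjmx T *m (_ *m _ *m _)]mulmxA.
by rewrite [adjmx T *m (_ *m _)]mulmxA T1_unitary mul1mx !mulmxA.
Qed.

Lemma t1conj_adj Y : adjmx (t1conj Y) = t1conj (adjmx Y).
Proof. by rewrite /t1conj !adjmxM adjmxK mulmxA. Qed.

Lemma trace_t1conj Y : \tr (t1conj Y) = \tr Y.
Proof. by rewrite /t1conj mxtrace_mulC mulmxA T1_unitary mul1mx. Qed.

Lemma hs_dot_t1conj X Y : hs_dot (t1conj X) (t1conj Y) = hs_dot X Y.
Proof. by rewrite /hs_dot t1conj_adj -t1conjM trace_t1conj. Qed.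

Lemma t1conj_diag (d : 'rV[C]_4) : d 0 (o4 1) = d 0 (o4 2) ->
  t1conj (diag_mx d) = diag_mx d.
Proof.
by move=> d12; rewrite /t1conj -diag_T1_comm// -mulmxA T1_unitary_r mulmx1.
Qed.

Lemma ketbra_t1 i j :
  ketbra (T *m delta_mx i 0) (T *m delta_mx j 0) = t1conj (delta_mx i j).
Proof.
rewrite /ketbra adjmxM /t1conj !mulmxA; congr (_ *m _).
rewrite -!mulmxA; congr (_ *m _); apply/matrixP => p q.
rewrite !mxE big_ord1 !mxE rmorph_nat !eqxx !andbT.
by case: (p == i); case: (q == j); rewrite ?(mulr0, mul0r, mulr1).
Qed.

Lemma braket_t1 i j Y :
  braket_mx (T *m delta_mx i 0) (t1conj Y) (T *m delta_mx j 0) = Y i j.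
Proof.
rewrite /braket_mx adjmxM mulmxA -!(mulmxA (adjmx (delta_mx _ _))) t1conjK.
rewrite mxE (bigD1 i)//= big1 ?addr0 => [|k ki].
  rewrite !mxE !eqxx conjC1 mul1r (bigD1 j)//= big1 ?addr0 => [|l lj].
    by rewrite mxE !eqxx mulr1.
  by rewrite mxE (negPf lj) mulr0.
by rewrite !mxE (negPf ki) conjC0 mul0r.
Qed.

Lemma hs_dot_delta i j Y : hs_dot (delta_mx i j) Y = Y i j.
Proof.
rewrite hs_dotE (bigD1 j)//= (bigD1 i)//= mxE !eqxx conjC1 mul1r.
rewrite big1 ?addr0 => [|k ki]; last by rewrite mxE (negPf ki) conjC0 mul0r.
rewrite big1 ?addr0// => l lj; rewrite big1// => k _.
by rewrite mxE (negPf lj) andbF conjC0 mul0r.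
Qed.

Section Transfer.
Variables (N : 'M[C]_4) (Ys : seq 'M[C]_4) (th : seq R).
Let H : 'M[C]_4 := ham E0 E1.
Hypothesis Nnormal : N *m adjmx N = adjmx N *m N.
Hypothesis Ys_on : hs_orthonormal Ys.
Hypothesis Ys_N : {in Ys, forall Y, N *m Y = Y *m N}.
Hypothesis Ys_Ns : {in Ys, forall Y, adjmx N *m Y = Y *m adjmx N}.
Hypothesis Ys_H : forall j : nat, (j < size Ys)%N ->
  H *m Ys`_j - Ys`_j *m H = - (th`_j)%:C%C *: Ys`_j.
Hypothesis Ys_span : forall Y (z : C), N *m Y = Y *m N ->
  H *m Y - Y *m H = z *: Y -> Y \in <<Ys>>%VS.

Let L := t1conj N.
Let Xs := map t1conj Ys.

Lemma ham_t1conj : t1conj H = H.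
Proof. by rewrite /H ham_diag t1conj_diag// !mxE. Qed.

Let Xs_nth (j : nat) : (j < size Xs)%N -> Xs`_j = t1conj Ys`_j.
Proof. by rewrite size_map => jX; rewrite (nth_map 0). Qed.

Let Lnormal : L *m adjmx L = adjmx L *m L.
Proof. by rewrite /L t1conj_adj -!t1conjM Nnormal. Qed.

Let Xs_on : hs_orthonormal Xs.
Proof.
move=> i j iX jX; rewrite !Xs_nth// hs_dot_t1conj.
by rewrite size_map in iX jX; exact: Ys_on.
Qed.

Let Ys_lt (j : 'I_(size Xs)) : (j < size Ys)%N.
Proof. by have := ltn_ord j; rewrite [X in (_ < X)%N]size_map. Qed.

Let Ys_in (j : 'I_(size Xs)) : Ys`_j \in Ys.
Proof. exact: mem_nth. Qed.

Let Xs_L (j : 'I_(size Xs)) : L *m Xs`_j = Xs`_j *m L.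
Proof. by rewrite (Xs_nth (ltn_ord j)) /L -!t1conjM (Ys_N (Ys_in j)). Qed.

Let Xs_Ls (j : 'I_(size Xs)) : adjmx L *m Xs`_j = Xs`_j *m adjmx L.
Proof. by rewrite (Xs_nth (ltn_ord j)) /L t1conj_adj -!t1conjM (Ys_Ns (Ys_in j)). Qed.

Let Xs_H (j : 'I_(size Xs)) :
  H *m Xs`_j - Xs`_j *m H = - (th`_j)%:C%C *: Xs`_j.
Proof.
rewrite (Xs_nth (ltn_ord j)) -ham_t1conj -!t1conjM -linearB (Ys_H (Ys_lt j)).
exact: linearZ.
Qed.

Let Xs_span X (z : C) : L *m X = X *m L -> adjmx L *m X = X *m adjmx L ->
  H *m X - X *m H = z *: X -> X \in <<Xs>>%VS.
Proof.
move=> LX _ HX; have [Y XE] : exists Y, X = t1conj Y.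
  by exists (adjmx T *m X *m T); rewrite t1conjVK.
have YYs : Y \in <<Ys>>%VS.
  apply: (@Ys_span _ z); apply: t1conj_inj.
    by rewrite !t1conjM -XE.
  by rewrite linearB linearZ /= !t1conjM -XE ham_t1conj.
have -> : Xs = map (linfun t1conj) Ys by apply: eq_map => Z; rewrite lfunE.
rewrite XE -limg_span; have -> : t1conj Y = linfun t1conj Y by rewrite lfunE.
exact: memv_img.
Qed.

Lemma t1conj_eigenbasis (lambda : seq C) : size lambda = size Ys ->
  (forall j : nat, (j < size Ys)%N -> lambda`_j = 'i%C * (th`_j)%:C%C) ->
  attractor_eigenbasis H L Xs lambda.
Proof.
move=> sz lamE; apply: (@attractor_eigenbasis_basis _ _ _ _ _ th) => //.
- exact: ham_hermitian.
- by rewrite size_map.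
- by move=> j; rewrite lamE.
Qed.

Lemma t1conj_asymptotic (rho : 'M[C]_4) (rho_as : R -> 'M[C]_4) :
  asymptotic_dynamics H L rho rho_as <-> forall t : R, 0 <= t -> rho_as t =
    t1conj (\sum_(k < size Ys)
      (cis (th`_k * t) * hs_dot Ys`_k (adjmx T *m rho *m T)) *: Ys`_k).
Proof.
have as_iff := @asymptotic_dynamicsP _ _ _ _ _ th (ham_hermitian E0 E1) Lnormal
  Xs_on Xs_L Xs_Ls Xs_H Xs_span rho rho_as.
have combE t : attractor_comb Xs th (fun k => hs_dot Xs`_k rho) t =
    t1conj (\sum_(k < size Ys)
      (cis (th`_k * t) * hs_dot Ys`_k (adjmx T *m rho *m T)) *: Ys`_k).
  rewrite /attractor_comb size_map linear_sum; apply: eq_bigr => k _.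
  rewrite linearZ /= Xs_nth ?size_map// -[in hs_dot _ rho](t1conjVK rho).
  by rewrite hs_dot_t1conj.
split=> [/as_iff rhoE t t0|rhoE]; first by rewrite rhoE// combE.
by apply/as_iff => t t0; rewrite rhoE// combE.
Qed.

End Transfer.
End T1Conjugation.

(** * The jump operator in the rotated basis *)

Section Core.
Variables (R : realType) (E0 E1 : R) (a b : R[i]) (c k m : R).
Local Notation C := R[i].
Local Notation E i j := (delta_mx (o4 i) (o4 j) : 'M[C]_4).
Hypothesis hE : E0 - E1 != 0.

Definition core : 'M[C]_4 := mx4_of_rows
  [:: [:: c%:C; 0; 0; 0];
      [:: 0; c%:C; 0; 0];
      [:: 0; 0; a; b];
      [:: 0; 0; cis (2 * k) * Num.conj b; a + m%:C * cis k]]%C.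

(** The lower block is a + e^{ik} K, where K has rows (0, e^{-ik} b) and (e^{ik} conj b, m) and is
    Hermitian because [m] is real; a scalar plus a multiple of a Hermitian matrix is normal. *)
Lemma core_normal : core *m adjmx core = adjmx core *m core.
Proof.
have e2 : cis (2 * k) = cis k * cis k :> C by rewrite -cisD; congr cis; ring.
have e2' : cis (- (2 * k)) = cis (- k) * cis (- k) :> C.
  by rewrite -cisD; congr cis; ring.
have e1 := cis_conj k.
apply/matrixP => i j; rewrite !mulmx4E !mxE.
elim/ord4_ind: i; elim/ord4_ind: j; rewrite /=.
all: rewrite ?rmorphD ?rmorphM /= ?conjCK ?conj_cis ?conj_real_complex ?conjC0 ?e2 ?e2'.
all: try by ring.
(* With phases and conjugates taken as independent variables, the remaining entries are polynomial
   identities modulo e e' = 1. *)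
all: move: (cis k) (cis (- k)) (Num.conj b) (Num.conj a) e1 => e e' b' a' e1.
all: by ring: e1.
Qed.

Lemma commutator_ham (Y : 'M[C]_4) i j :
  (ham E0 E1 *m Y - Y *m ham E0 E1) i j =
  (level E0 E1 i - level E0 E1 j)%:C%C * Y i j.
Proof.
rewrite ham_diag mxE [X in _ + X]mxE mul_diag_mx mul_mx_diag !mxE rmorphB /=.
by rewrite mulrBl; congr (_ - _); rewrite mulrC.
Qed.

Definition coupled_basis : seq 'M[C]_4 :=
  [:: E 0 0; E 1 1; E 0 1; E 1 0; isqrt2 *: (E 2 2 + E 3 3)].

Definition uncoupled_basis : seq 'M[C]_4 :=
  [:: E 0 0; E 1 1; E 0 1; E 1 0; E 2 2; E 3 3].

(* Beyond the end of this list [nth] returns the frequency 0 of the remaining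
   attractors. *)
Definition frequencies : seq R := [:: 0; 0; - (E0 - E1); E0 - E1].

Lemma core_comm_coupled : {in coupled_basis, forall Y, core *m Y = Y *m core}.
Proof.
move=> Y; rewrite !inE.
do ![case/predU1P => [->|]|move/eqP => ->]; apply/matrixP => i j; rewrite !mulmx4E !mxE;
  by elim/ord4_ind: i; elim/ord4_ind: j; rewrite /= ?mulr0n ?mulr1n; ring.
Qed.

(** Taking adjoints in the relation for the adjoint of [Y], which is again in the family, gives the
    relation with the adjoint of [core]. *)
Lemma core_adj_comm (Ys : seq 'M[C]_4) :
  {in Ys, forall Y, core *m Y = Y *m core} -> {in Ys, forall Y, adjmx Y \in Ys} ->
  {in Ys, forall Y, adjmx core *m Y = Y *m adjmx core}.
Proof.
by move=> Nc Ya Y YYs; rewrite -[Y]adjmxK -!adjmxM Nc ?Ya.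
Qed.

Lemma adjmx_delta (i j : 'I_4) : adjmx (delta_mx i j) = delta_mx j i :> 'M[C]_4.
Proof. by apply/matrixP => p q; rewrite !mxE rmorph_nat andbC. Qed.

Lemma adjmx_coupled : {in coupled_basis, forall Y, adjmx Y \in coupled_basis}.
Proof.
have adjmxD (X Z : 'M[C]_4) : adjmx (X + Z) = adjmx X + adjmx Z.
  by apply/matrixP => p q; rewrite !mxE rmorphD.
move=> Y; rewrite !inE.
do ![case/predU1P => [->|]|move/eqP => ->];
  by rewrite ?adjmxZ ?adjmxD !adjmx_delta ?conj_isqrt2 eqxx ?orbT.
Qed.

Lemma adjmx_uncoupled : {in uncoupled_basis, forall Y, adjmx Y \in uncoupled_basis}.
Proof.
move=> Y; rewrite !inE.
by do ![case/predU1P => [->|]|move/eqP => ->]; rewrite !adjmx_delta eqxx ?orbT.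
Qed.

Lemma core_comm_uncoupled : b = 0 ->
  {in uncoupled_basis, forall Y, core *m Y = Y *m core}.
Proof.
move=> b0 Y; rewrite !inE.
do ![case/predU1P => [->|]|move/eqP => ->]; apply/matrixP => i j; rewrite !mulmx4E !mxE b0;
  by elim/ord4_ind: i; elim/ord4_ind: j; rewrite /= ?conjC0 ?mulr0n ?mulr1n; ring.
Qed.

Lemma ham_coupled (j : nat) : (j < size coupled_basis)%N ->
  ham E0 E1 *m coupled_basis`_j - coupled_basis`_j *m ham E0 E1 =
  - (frequencies`_j)%:C%C *: coupled_basis`_j.
Proof.
move: j => [|[|[|[|[|//]]]]] _ /=; apply/matrixP => i j; rewrite commutator_ham !mxE;
  by elim/ord4_ind: i; elim/ord4_ind: j; rewrite /level /= ?mulr0n ?mulr1n; ring.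
Qed.

Lemma ham_uncoupled (j : nat) : (j < size uncoupled_basis)%N ->
  ham E0 E1 *m uncoupled_basis`_j - uncoupled_basis`_j *m ham E0 E1 =
  - (frequencies`_j)%:C%C *: uncoupled_basis`_j.
Proof.
move: j => [|[|[|[|[|[|//]]]]]] _ /=; apply/matrixP => i j; rewrite commutator_ham !mxE;
  by elim/ord4_ind: i; elim/ord4_ind: j; rewrite /level /= ?mulr0n ?mulr1n; ring.
Qed.

Lemma uncoupled_orthonormal : hs_orthonormal uncoupled_basis.
Proof.
move=> [|[|[|[|[|[|//]]]]]] [|[|[|[|[|[|//]]]]]] _ _ /=; by rewrite hs_dot_delta mxE.
Qed.

Lemma hs_dot_isqrt2 (Y : 'M[C]_4) : hs_dot (isqrt2 *: (E 2 2 + E 3 3)) Y =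
  isqrt2 * (Y (o4 2) (o4 2) + Y (o4 3) (o4 3)).
Proof.
rewrite -(hs_dot_delta (o4 2) (o4 2) Y) -(hs_dot_delta (o4 3) (o4 3) Y).
rewrite /hs_dot adjmxZ conj_isqrt2 -scalemxAl mxtraceZ -mxtraceD -mulmxDl.
congr (_ * \tr (_ *m _)).
by apply/matrixP => p q; rewrite !mxE rmorphD.
Qed.

Lemma coupled_orthonormal : hs_orthonormal coupled_basis.
Proof.
have h : isqrt2 * (isqrt2 + isqrt2) = 1 :> C.
  by rewrite mulrDr isqrt2_sqr; field.
move=> [|[|[|[|[|//]]]]] [|[|[|[|[|//]]]]] _ _ /=; rewrite ?hs_dot_isqrt2 ?hs_dot_delta !mxE /=.
all: by rewrite ?(mulr0n, mulr1n, addr0, add0r, mulr1, mulr0).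
Qed.

Section Commutant.
Variables (Y : 'M[C]_4) (z : C).
Hypothesis NY : core *m Y = Y *m core.
Hypothesis HY : ham E0 E1 *m Y - Y *m ham E0 E1 = z *: Y.

Let commE i j : core i (o4 0) * Y (o4 0) j + core i (o4 1) * Y (o4 1) j
    + core i (o4 2) * Y (o4 2) j + core i (o4 3) * Y (o4 3) j =
  Y i (o4 0) * core (o4 0) j + Y i (o4 1) * core (o4 1) j
    + Y i (o4 2) * core (o4 2) j + Y i (o4 3) * core (o4 3) j.
Proof. by rewrite -!mulmx4E NY. Qed.

(** A nonzero entry forces [z] to equal its Bohr frequency, so two entries with different
    frequencies cannot both be nonzero. *)
Let bohr i j i' j' :
  level E0 E1 i - level E0 E1 j != level E0 E1 i' - level E0 E1 j' ->
  Y i j = 0 \/ Y i' j' = 0.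
Proof.
move=> lev; have hz p q : ((level E0 E1 p - level E0 E1 q)%:C%C - z) * Y p q = 0.
  by rewrite mulrBl -commutator_ham HY mxE subrr.
have [y0|y0] := eqVneq (Y i j) 0; [by left|right].
have [//|y0'] := eqVneq (Y i' j') 0.
have /eqP := hz i j; rewrite mulf_eq0 (negPf y0) orbF subr_eq0 => /eqP z1.
have /eqP := hz i' j'; rewrite mulf_eq0 (negPf y0') orbF subr_eq0 -z1 => /eqP/complexI z2.
by rewrite z2 eqxx in lev.
Qed.

(** The separated pairs are those that [b] and [b'] couple in the commutation relations. Their
    frequencies differ by E0 - E1 up to sign, or by twice that for the pair 23, 32. *)
Let lev02_03 : level E0 E1 (o4 0) - level E0 E1 (o4 2) !=
  level E0 E1 (o4 0) - level E0 E1 (o4 3).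
Proof.
apply: contra_neq hE => /eqP; rewrite -subr_eq0 /level /= => /eqP D0.
by apply/eqP; rewrite -oppr_eq0; apply/eqP; rewrite -[RHS]D0; ring.
Qed.
Let lev12_13 : level E0 E1 (o4 1) - level E0 E1 (o4 2) !=
  level E0 E1 (o4 1) - level E0 E1 (o4 3).
Proof.
apply: contra_neq hE => /eqP; rewrite -subr_eq0 /level /= => /eqP D0.
by apply/eqP; rewrite -oppr_eq0; apply/eqP; rewrite -[RHS]D0; ring.
Qed.
Let lev20_30 : level E0 E1 (o4 2) - level E0 E1 (o4 0) !=
  level E0 E1 (o4 3) - level E0 E1 (o4 0).
Proof.
apply: contra_neq hE => /eqP; rewrite -subr_eq0 /level /= => /eqP D0.
by rewrite -[RHS]D0; ring.
Qed.
Let lev21_31 : level E0 E1 (o4 2) - level E0 E1 (o4 1) !=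
  level E0 E1 (o4 3) - level E0 E1 (o4 1).
Proof.
apply: contra_neq hE => /eqP; rewrite -subr_eq0 /level /= => /eqP D0.
by rewrite -[RHS]D0; ring.
Qed.
Let lev23_32 : level E0 E1 (o4 2) - level E0 E1 (o4 3) !=
  level E0 E1 (o4 3) - level E0 E1 (o4 2).
Proof.
apply: contra_neq hE => /eqP; rewrite -subr_eq0 /level /= => /eqP D0.
have /eqP : (E0 - E1) *+ 2 = 0 by rewrite -[RHS]D0; ring.
by rewrite mulrn_eq0 => /eqP.
Qed.

Let b' := cis (2 * k) * Num.conj b.
Let d := a + m%:C%C * cis k.

(** In each coupled pair one entry vanishes by [bohr]; a commutation equation then reduces to b or
    b' times the other entry, which vanishes too. *)
Lemma commutant_coupled : b != 0 -> Y \in <<coupled_basis>>%VS.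
Proof.
move=> b0.
have b'0 : b' != 0.
  rewrite mulf_neq0 ?conjC_eq0//; apply: contra_eq_neq (cis_conj (2 * k)) => ->.
  by rewrite mul0r eq_sym oner_eq0.
have zero (x y u v : C) : x = 0 \/ y = 0 -> (x = 0 -> y * v = 0) ->
    (y = 0 -> x * u = 0) -> u != 0 -> v != 0 -> x = 0 /\ y = 0.
  move=> [x0|y0] hx hy u0 v0; split=> //.
  - by have /eqP := hx x0; rewrite mulf_eq0 (negPf v0) orbF => /eqP.
  - by have /eqP := hy y0; rewrite mulf_eq0 (negPf u0) orbF => /eqP.
have := commE (o4 0) (o4 2); have := commE (o4 0) (o4 3).
have := commE (o4 1) (o4 2); have := commE (o4 1) (o4 3).
have := commE (o4 2) (o4 0); have := commE (o4 3) (o4 0).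
have := commE (o4 2) (o4 1); have := commE (o4 3) (o4 1).
have := commE (o4 2) (o4 2); have := commE (o4 2) (o4 3).
rewrite !mxE /= -/b' -/d !(mul0r, mulr0, addr0, add0r).
move=> e23 e22 e31 e21 e30 e20 e13 e12 e03 e02.
have [y02 y03] : Y (o4 0) (o4 2) = 0 /\ Y (o4 0) (o4 3) = 0.
  apply: (zero _ _ b b') => // [|y0|y0]; first exact: bohr.
    by move: e02; rewrite y0 mulr0 mul0r add0r => <-.
  by move: e03; rewrite y0 mulr0 mul0r addr0 => <-.
have [y12 y13] : Y (o4 1) (o4 2) = 0 /\ Y (o4 1) (o4 3) = 0.
  apply: (zero _ _ b b') => // [|y0|y0]; first exact: bohr.
    by move: e12; rewrite y0 mulr0 mul0r add0r => <-.
  by move: e13; rewrite y0 mulr0 mul0r addr0 => <-.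
have [y20 y30] : Y (o4 2) (o4 0) = 0 /\ Y (o4 3) (o4 0) = 0.
  apply: (zero _ _ b' b) => // [|y0|y0]; first exact: bohr.
    by move: e20; rewrite y0 mulr0 mul0r add0r mulrC.
  by move: e30; rewrite y0 mulr0 mul0r addr0 mulrC.
have [y21 y31] : Y (o4 2) (o4 1) = 0 /\ Y (o4 3) (o4 1) = 0.
  apply: (zero _ _ b' b) => // [|y0|y0]; first exact: bohr.
    by move: e21; rewrite y0 mulr0 mul0r add0r mulrC.
  by move: e31; rewrite y0 mulr0 mul0r addr0 mulrC.
have [y23 y32] : Y (o4 2) (o4 3) = 0 /\ Y (o4 3) (o4 2) = 0.
  apply: (zero _ _ b' b) => // [|y0|y0]; first exact: bohr.
    by move/eqP: e22; rewrite y0 mul0r addr0 [a * _]mulrC addrC -subr_eq0 addrK mulrC => /eqP.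
  by move/eqP: e22; rewrite y0 mulr0 addr0 [a * _]mulrC eq_sym addrC -subr_eq0 addrK => /eqP.
(* Entry (2, 3) of the relation is now b Y33 = Y22 b: the coupling merges the last two diagonal
   attractors into one. *)
have y33 : Y (o4 3) (o4 3) = Y (o4 2) (o4 2).
  move: e23; rewrite y23 mulr0 mul0r add0r addr0 mulrC; exact: mulIf.
have s0 : isqrt2 != 0 :> C.
  apply/eqP => s0; have /eqP := isqrt2_sqr R.
  by rewrite s0 mul0r eq_sym invr_eq0 pnatr_eq0.
have -> : Y = Y (o4 0) (o4 0) *: E 0 0 + Y (o4 1) (o4 1) *: E 1 1
    + Y (o4 0) (o4 1) *: E 0 1 + Y (o4 1) (o4 0) *: E 1 0
    + (Y (o4 2) (o4 2) / isqrt2) *: (isqrt2 *: (E 2 2 + E 3 3)).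
  rewrite scalerA divfK//; apply/matrixP => i j; rewrite !mxE.
  by elim/ord4_ind: i; elim/ord4_ind: j;
    rewrite /= ?(y02, y03, y12, y13, y20, y30, y21, y31, y23, y32, y33);
    rewrite ?(mulr0n, mulr1n, mulr0, mulr1, add0r, addr0).
by rewrite !rpredD// rpredZ// memv_span// !inE eqxx ?orbT.
Qed.

(** Now [core] is diagonal with entries c, c, a, d. The hypotheses say that c, a, d are distinct
    (those on [m] mean d != a and d != c), so only the leading 2 x 2 block and the last two diagonal
    entries of [Y] survive. *)
Lemma commutant_uncoupled : b = 0 -> a != c%:C%C -> m != 0 ->
  m%:C%C != cis (- k) * (c%:C%C - a) -> Y \in <<uncoupled_basis>>%VS.
Proof.
move=> b0 ac m0 mc.
have b'0 : b' = 0 by rewrite /b' b0 conjC0 mulr0.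
have cisk0 : cis k != 0 :> C.
  by apply: contra_eq_neq (cis_conj k) => ->; rewrite mul0r eq_sym oner_eq0.
have ca : c%:C%C != a by rewrite eq_sym.
have dc : d != c%:C%C.
  apply: contra_neq mc => <-; rewrite /d addrAC subrr add0r mulrCA.
  by rewrite [cis (- k) * _]mulrC cis_conj mulr1.
have cd : c%:C%C != d by rewrite eq_sym.
have da : d != a.
  by rewrite /d -subr_eq0 addrAC subrr add0r mulf_neq0// (inj_eq (@complexI R)).
have ad : a != d by rewrite eq_sym.
have zero (x p q : C) : p != q -> p * x = x * q -> x = 0.
  move=> pq /eqP; rewrite [x * q]mulrC -subr_eq0 -mulrBl mulf_eq0 subr_eq0.
  by rewrite (negPf pq) => /eqP.
have := commE (o4 0) (o4 2); have := commE (o4 0) (o4 3).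
have := commE (o4 1) (o4 2); have := commE (o4 1) (o4 3).
have := commE (o4 2) (o4 0); have := commE (o4 3) (o4 0).
have := commE (o4 2) (o4 1); have := commE (o4 3) (o4 1).
have := commE (o4 3) (o4 2); have := commE (o4 2) (o4 3).
rewrite !mxE /= -/b' -/d b'0 b0 !(mul0r, mulr0, addr0, add0r).
move=> /(zero _ _ _ ad) y23 /(zero _ _ _ da) y32.
move=> /(zero _ _ _ dc) y31 /(zero _ _ _ ac) y21.
move=> /(zero _ _ _ dc) y30 /(zero _ _ _ ac) y20.
move=> /(zero _ _ _ cd) y13 /(zero _ _ _ ca) y12.
move=> /(zero _ _ _ cd) y03 /(zero _ _ _ ca) y02.
have -> : Y = Y (o4 0) (o4 0) *: E 0 0 + Y (o4 1) (o4 1) *: E 1 1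
    + Y (o4 0) (o4 1) *: E 0 1 + Y (o4 1) (o4 0) *: E 1 0
    + Y (o4 2) (o4 2) *: E 2 2 + Y (o4 3) (o4 3) *: E 3 3.
  apply/matrixP => i j; rewrite !mxE.
  by elim/ord4_ind: i; elim/ord4_ind: j;
    rewrite /= ?(y02, y03, y12, y13, y20, y30, y21, y31, y23, y32);
    rewrite ?(mulr0n, mulr1n, mulr0, mulr1, add0r, addr0).
by rewrite !rpredD// rpredZ// memv_span// !inE eqxx ?orbT.
Qed.

End Commutant.

End Core.

(** * The evolved projection in the rotated basis *)

Section EvolvedProjection.
Variables (R : realType) (E0 E1 phi : R).
Local Notation C := R[i].
Local Notation T := (T1 phi).
Local Notation E i j := (delta_mx (o4 i) (o4 j) : 'M[C]_4).

Lemma evolution_ham t : evolution (ham E0 E1) t =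
  t1conj phi (diag_mx (\row_j cis (- (t * level E0 E1 j)))).
Proof. by rewrite ham_diag evolution_diag t1conj_diag// !mxE. Qed.

Lemma projP_t1 : projP phi = t1conj phi (E 0 0 + E 1 1).
Proof.
have [k00E p1E _ _] := ket_T1 phi.
by rewrite /projP k00E p1E !ketbra_t1 linearD.
Qed.

Lemma projPt_t1 : projPt phi = t1conj phi (E 2 2 + E 3 3).
Proof.
have [_ _ p2E k11E] := ket_T1 phi.
by rewrite /projPt p2E k11E !ketbra_t1 linearD addrC.
Qed.

Lemma diag_sandwich (K : comPzRingType) (n : nat) (d p d' : 'rV[K]_n) (r : 'M[K]_n) i j :
  (diag_mx d *m diag_mx p *m r *m diag_mx p *m diag_mx d') i j =
  p 0 i * p 0 j * (d 0 i * r i j * d' 0 j).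
Proof.
rewrite mul_mx_diag mxE mul_mx_diag mxE -mulmxA mul_diag_mx mxE mul_diag_mx mxE.
by ring.
Qed.

(** In the rotated basis all four outer factors are diagonal, so they act entry by entry: the
    projections keep the leading 2 x 2 block, and the evolutions multiply entry (i, j) by exp (i t
    (level j - level i)). *)
Lemma evolved_projP (t : R) (r : 'M[C]_4) :
  let Z := evolution (ham E0 E1) t *m projP phi *m t1conj phi r *m projP phi
    *m evolution (ham E0 E1) (- t) in
  let w := (- (E0 - E1)) * t in
  Z = t1conj phi (r (o4 0) (o4 0) *: E 0 0 + r (o4 1) (o4 1) *: E 1 1
    + (cis w * r (o4 0) (o4 1)) *: E 0 1 + (cis (- w) * r (o4 1) (o4 0)) *: E 1 0).
Proof.
move=> Z w; rewrite /Z !evolution_ham projP_t1 -!t1conjM; congr t1conj.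
have PE : E 0 0 + E 1 1 = diag_mx (\row_j nth 0 [:: 1; 1; 0; 0] j).
  apply/matrixP => i j; rewrite !mxE.
  by elim/ord4_ind: i; elim/ord4_ind: j; rewrite /= ?mulr0n ?mulr1n ?addr0 ?add0r.
apply/matrixP => i j.
rewrite PE diag_sandwich !mxE.
have cis0 : cis 0 = 1 :> C by rewrite /cis cos0 sin0.
have cisE (p q : 'I_4) x : cis (- (t * level E0 E1 p)) * x * cis (- (- t * level E0 E1 q)) =
    cis (t * (level E0 E1 q - level E0 E1 p)) * x :> C.
  by rewrite mulrAC -cisD; congr (cis _ * _); ring.
rewrite cisE.
elim/ord4_ind: i; elim/ord4_ind: j; rewrite /= ?mulr0n ?mulr1n.
all: rewrite ?(mulr0, mul0r, addr0, add0r, mulr1, mul1r)//.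
- by rewrite subrr mulr0 cis0 mul1r.
- by congr (cis _ * _); rewrite /w /level /=; ring.
- by congr (cis _ * _); rewrite /w /level /=; ring.
- by rewrite subrr mulr0 cis0 mul1r.
Qed.

End EvolvedProjection.

Theorem mainTheorem5 (R : realType) (E0 E1 : R) (hE : E0 - E1 != 0)
    (phi : R) (hphi : 0 <= phi < 2 * pi) (a b : R[i]) (c k m : R) :
  let H := ham E0 E1 in
  let L := lindblad_op phi a b c k m in
  let dE : R[i] := (E0 - E1)%:C%C in
  let k00 : 'cV[R[i]]_4 := ket 0 0 in
  let k11 : 'cV[R[i]]_4 := ket 1 1 in
  let p1 := psi1 phi in
  let p2 := psi2 phi in
  let P := projP phi in
  let Pt := projPt phi in
  (b != 0 ->
     attractor_eigenbasis H L
       [:: ketbra k00 k00; ketbra p1 p1; ketbra k00 p1; ketbra p1 k00;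
           isqrt2 *: Pt]
       [:: 0; 0; - ('i%C * dE); 'i%C * dE; 0] /\
     forall rho0 : 'M[R[i]]_4, density rho0 ->
     forall rho_as : R -> 'M[R[i]]_4,
       asymptotic_dynamics H L rho0 rho_as <->
       (forall t : R, 0 <= t ->
          rho_as t = evolution H t *m P *m rho0 *m P *m evolution H (- t)
                     + (\tr (Pt *m rho0) / 2) *: Pt)) /\
  (b = 0 -> a != c%:C%C -> m != 0 -> m%:C%C != cis (- k) * (c%:C%C - a) ->
     attractor_eigenbasis H L
       [:: ketbra k00 k00; ketbra p1 p1; ketbra k00 p1; ketbra p1 k00;
           ketbra p2 p2; ketbra k11 k11]
       [:: 0; 0; - ('i%C * dE); 'i%C * dE; 0; 0] /\
     forall rho0 : 'M[R[i]]_4, density rho0 ->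
     forall rho_as : R -> 'M[R[i]]_4,
       asymptotic_dynamics H L rho0 rho_as <->
       (forall t : R, 0 <= t ->
          rho_as t = evolution H t *m P *m rho0 *m P *m evolution H (- t)
                     + braket_mx k11 rho0 k11 *: ketbra k11 k11
                     + braket_mx p2 rho0 p2 *: ketbra p2 p2)).
Proof.
move=> H L dE k00 k11 p1 p2 P Pt.
have [k00E p1E p2E k11E] := ket_T1 phi.
have LE : L = t1conj phi (core a b c k m) by [].
have cis0 : cis 0 = 1 :> R[i] by rewrite /cis cos0 sin0.
have Nn := core_normal a b c k m.
split=> [b0|b0 ac m0 mc].
- have YsN := core_comm_coupled a b c k m.
  have YsNs := core_adj_comm YsN (@adjmx_coupled R).
  have span := commutant_coupled hE.
  have -> : [:: ketbra k00 k00; ketbra p1 p1; ketbra k00 p1; ketbra p1 k00; isqrt2 *: Pt]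
      = map (t1conj phi) (coupled_basis R).
    by rewrite /= linearZ /= -projPt_t1 /k00 /p1 k00E p1E !ketbra_t1.
  split.
    rewrite LE; apply: (@t1conj_eigenbasis _ E0 E1 phi _ _ (frequencies E0 E1)) => //.
    - exact: coupled_orthonormal.
    - exact: ham_coupled.
    - by move=> Y z NY HY; apply: (span _ _ _ _ _ _ _ NY HY b0).
    - move=> [|[|[|[|[|//]]]]] _ /=; rewrite ?rmorphN ?mulr0 ?mulrN//.
  move=> rho _ rho_as; rewrite LE.
  have as_iff := @t1conj_asymptotic _ E0 E1 phi _ _ (frequencies E0 E1) Nn
    (@coupled_orthonormal R) YsN YsNs (@ham_coupled R E0 E1)
    (fun Y z NY HY => span _ _ _ _ _ Y z NY HY b0) rho rho_as.
  set r := adjmx (T1 phi) *m rho *m T1 phi in as_iff.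
  have rhoE : rho = t1conj phi r by rewrite t1conjVK.
  have combE t : t1conj phi (\sum_(j < size (coupled_basis R))
      (cis ((frequencies E0 E1)`_j * t) * hs_dot (coupled_basis R)`_j r)
        *: (coupled_basis R)`_j) =
      evolution H t *m P *m rho *m P *m evolution H (- t)
      + (\tr (Pt *m rho) / 2) *: Pt.
    rewrite {1}rhoE evolved_projP /Pt projPt_t1 rhoE -t1conjM trace_t1conj.
    rewrite -linearZ -linearD; congr t1conj.
    rewrite !big_ord_recl big_ord0 /= !hs_dot_delta hs_dot_isqrt2 !mul0r cis0 !mul1r.
    have trd i : \tr (delta_mx i i *m r) = r i i.
      by rewrite -[RHS](hs_dot_delta i i) /hs_dot adjmx_delta.
    have wE : - (- (E0 - E1) * t) = (E0 - E1) * t by rewrite mulNr opprK.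
    have trD : \tr ((delta_mx (o4 2) (o4 2) + delta_mx (o4 3) (o4 3)) *m r) =
        r (o4 2) (o4 2) + r (o4 3) (o4 3) by rewrite mulmxDl mxtraceD !trd.
    (* One [isqrt2] comes from the scalar product and one from the normalized attractor; together
       they give the 1/2 in front of the trace. *)
    rewrite wE trD scalerA [isqrt2 * _]mulrC -mulrA isqrt2_sqr addr0.
    move: (_ *: delta_mx (o4 0) (o4 0)) (_ *: delta_mx (o4 1) (o4 1)) => A00 A11.
    move: (_ *: delta_mx (o4 0) (o4 1)) (_ *: delta_mx (o4 1) (o4 0)) => A01 A10.
    by move: (_ *: (delta_mx _ _ + _)) => A22; rewrite !addrA.
  by split=> [/as_iff rE t t0|rE]; [rewrite rE// combE|apply/as_iff => t t0; rewrite rE// combE].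
- have YsN := core_comm_uncoupled a c k m b0.
  have YsNs := core_adj_comm YsN (@adjmx_uncoupled R).
  have -> : [:: ketbra k00 k00; ketbra p1 p1; ketbra k00 p1; ketbra p1 k00;
      ketbra p2 p2; ketbra k11 k11] = map (t1conj phi) (uncoupled_basis R).
    by rewrite /= /k00 /p1 /p2 /k11 k00E p1E p2E k11E !ketbra_t1.
  split.
    rewrite LE; apply: (@t1conj_eigenbasis _ E0 E1 phi _ _ (frequencies E0 E1)) => //.
    - exact: uncoupled_orthonormal.
    - exact: ham_uncoupled.
    - by move=> Y z NY _; exact: (commutant_uncoupled NY b0 ac m0 mc).
    - move=> [|[|[|[|[|[|//]]]]]] _ /=; rewrite ?rmorphN ?mulr0 ?mulrN//.
  move=> rho _ rho_as; rewrite LE.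
  have as_iff := @t1conj_asymptotic _ E0 E1 phi _ _ (frequencies E0 E1) Nn
    (@uncoupled_orthonormal R) YsN YsNs (@ham_uncoupled R E0 E1)
    (fun Y z NY _ => commutant_uncoupled NY b0 ac m0 mc) rho rho_as.
  set r := adjmx (T1 phi) *m rho *m T1 phi in as_iff.
  have rhoE : rho = t1conj phi r by rewrite t1conjVK.
  have combE t : t1conj phi (\sum_(j < size (uncoupled_basis R))
      (cis ((frequencies E0 E1)`_j * t) * hs_dot (uncoupled_basis R)`_j r)
        *: (uncoupled_basis R)`_j) =
      evolution H t *m P *m rho *m P *m evolution H (- t)
      + braket_mx k11 rho k11 *: ketbra k11 k11 + braket_mx p2 rho p2 *: ketbra p2 p2.
    rewrite {1}rhoE evolved_projP /k11 /p2 k11E p2E rhoE !braket_t1 !ketbra_t1.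
    rewrite -!linearZ -!linearD; congr t1conj.
    rewrite !big_ord_recl big_ord0 /= !hs_dot_delta !mul0r cis0 !mul1r.
    have wE : - (- (E0 - E1) * t) = (E0 - E1) * t by rewrite mulNr opprK.
    rewrite wE addr0.
    move: (_ *: delta_mx (o4 0) (o4 0)) (_ *: delta_mx (o4 1) (o4 1)) => A00 A11.
    move: (_ *: delta_mx (o4 0) (o4 1)) (_ *: delta_mx (o4 1) (o4 0)) => A01 A10.
    move: (_ *: delta_mx (o4 2) (o4 2)) (_ *: delta_mx (o4 3) (o4 3)) => A22 A33.
    (* The basis lists |psi2> before |11>, the stated sum the other way round. *)
    by rewrite !addrA addrAC.
  by split=> [/as_iff rE t t0|rE]; [rewrite rE// combE|apply/as_iff => t t0; rewrite rE// combE].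
Qed.
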